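(* Let $\ell$ be a prime number and let $\alpha\in\mathbb{Q}$ be a rational number, regarded as an element of $\mathbb{Q}_\ell$. (i) The Ruban continued fraction expansion of $\alpha$ in $\mathbb{Q}_\ell$ terminates if and only if all complete quotients of $\alpha$ are non-negative; moreover, there is an algorithm to decide in a finite number of steps whether this happens. (ii) If the Ruban continued fraction expansion of $\alpha$ does not terminate, then it is periodic with all partial quotients eventually equal to $\ell-\ell^{-1}$; in this case, the pre-periodic part can be effectively computed.
   Context: Let $\ell$ be a prime, $v$ the $\ell$-adic valuation on $\mathbb{Q}_\ell$ and $|x|_\ell=\ell^{-v(x)}$. For $\alpha\in\mathbb{Q}_\ell$ the $\ell$-adic integral part $\lfloor\alpha\rfloor_\ell$ is the unique $a\in\mathbb{Z}[1/\ell]$ with $0\le a<\ell$ and $|\alpha-a|_\ell<1$. The Ruban continued fraction (RCF) expansion of $\alpha$ is defined by $\alpha_0:=\alpha$, $a_n:=\lfloor\alpha_n\rfloor_\ell$, $r_n:=\alpha_n-a_n$, and $\alpha_{n+1}:=1/r_n$ whenever $r_n\neq 0$; if $r_n=0$ for some $n$ the procedure stops and the expansion is said to terminate. The $a_n$ are the partial quotients, and the $\alpha_n$ (including $\alpha_0=\alpha$) are the complete quotients. If $\alpha$ is rational, all $\alpha_n$ are rational, and their sign is that of rational numbers. ''Periodic'' means infinite and eventually periodic. *)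

(* Defs.v *)
From HB Require Import structures.
From mathcomp Require Import all_boot all_order all_algebra.
From mathcomp Require Import boolp classical_sets functions.
From mathcomp Require Import generic_quotient ring_quotient ring.
Set Implicit Arguments.
Unset Strict Implicit.
Unset Printing Implicit Defensive.
Import Order.TTheory GRing.Theory Num.Theory.
Local Open Scope ring_scope.
Local Open Scope quotient_scope.

Section PadicAbs.
Variable l : nat.

(* The value at 0 is junk; padic_abs treats 0 separately. *)
Definition padic_val (x : rat) : int :=
  (logn l `|numq x|)%:Z - (logn l `|denq x|)%:Z.

Definition padic_abs (x : rat) : rat :=
  if x == 0 then 0 else l%:R ^ (- padic_val x).

Hypothesis pr : prime l.

Let l_gt0 : 0 < l%:R :> rat.
Proof. by rewrite ltr0n prime_gt0. Qed.

Let l_gt1 : 1 < l%:R :> rat.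
Proof. by rewrite ltr1n prime_gt1. Qed.

Let l_neq0 : l%:R != 0 :> rat.
Proof. by rewrite lt0r_neq0. Qed.

Lemma padic_abs0 : padic_abs 0 = 0.
Proof. by rewrite /padic_abs eqxx. Qed.

Lemma padic_abs_ge0 x : 0 <= padic_abs x.
Proof. by rewrite /padic_abs; case: eqP => // _; rewrite exprz_ge0 // ltW. Qed.

Lemma padic_abs_gt0 x : x != 0 -> 0 < padic_abs x.
Proof. by rewrite /padic_abs => /negPf->; rewrite exprz_gt0. Qed.

Lemma padic_val_frac (a b : int) : a != 0 -> b != 0 ->
  padic_val (a%:~R / b%:~R) = (logn l `|a|)%:Z - (logn l `|b|)%:Z.
Proof.
move=> a0 b0; set x := _ / _.
have x0 : x != 0 by rewrite mulf_neq0 ?invr_eq0 ?intr_eq0.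
have E : numq x * b = a * denq x.
  apply/eqP; rewrite -(eqr_int rat) !intrM; apply/eqP.
  have : x = (numq x)%:~R / (denq x)%:~R by rewrite divq_num_den.
  have d0 : (denq x)%:~R != 0 :> rat by rewrite intr_eq0 denq_neq0.
  have b0' : b%:~R != 0 :> rat by rewrite intr_eq0.
  move=> /(congr1 (fun y => y * (denq x)%:~R * b%:~R)).
  rewrite {1}/x divfK // => <-.
  by rewrite mulrAC divfK.
move/(congr1 (fun z : int => logn l `|z|%N)): E.
rewrite !abszM !lognM ?absz_gt0 ?denq_neq0 ?numq_eq0 //.
rewrite /padic_val => E; apply/eqP.
by rewrite subr_eq addrAC eq_sym subr_eq -!PoszD E addnC.
Qed.

Lemma padic_valM x y : x != 0 -> y != 0 ->
  padic_val (x * y) = padic_val x + padic_val y.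
Proof.
move=> x0 y0; rewrite -{1}[x]divq_num_den -{1}[y]divq_num_den mulf_div -!intrM.
rewrite padic_val_frac ?mulf_neq0 ?denq_neq0 ?numq_eq0 //.
rewrite !abszM !lognM ?absz_gt0 ?denq_neq0 ?numq_eq0 //.
by rewrite !PoszD opprD addrACA.
Qed.

Lemma padic_absM x y : padic_abs (x * y) = padic_abs x * padic_abs y.
Proof.
rewrite /padic_abs mulf_eq0; case: (eqVneq x 0) => [|x0]; first by rewrite mul0r.
case: (eqVneq y 0) => [|y0] /=; first by rewrite mulr0.
by rewrite padic_valM // opprD expfzDr.
Qed.

Lemma padic_abs1 : padic_abs 1 = 1.
Proof. by rewrite /padic_abs oner_eq0 /padic_val /= logn1 subrr. Qed.

Lemma padic_absV x : padic_abs x^-1 = (padic_abs x)^-1.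
Proof.
have [->|x0] := eqVneq x 0; first by rewrite padic_abs0 !invr0 padic_abs0.
have a0 : padic_abs x != 0 by rewrite gt_eqF ?padic_abs_gt0.
by apply: (mulfI a0); rewrite -padic_absM !divff // padic_abs1.
Qed.

Lemma padic_absN x : padic_abs (- x) = padic_abs x.
Proof.
by rewrite /padic_abs oppr_eq0 /padic_val numqN denqN abszN.
Qed.

Lemma padic_absB x y : padic_abs (x - y) = padic_abs (y - x).
Proof. by rewrite -padic_absN opprB. Qed.

Lemma padic_val_add x y : x != 0 -> y != 0 -> x + y != 0 ->
  Num.min (padic_val x) (padic_val y) <= padic_val (x + y).
Proof.
move=> x0 y0; rewrite -[x]divq_num_den -[y]divq_num_den.
set a := numq x; set b := denq x; set c := numq y; set d := denq y.
have b0 : b != 0 by rewrite denq_neq0.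
have d0 : d != 0 by rewrite denq_neq0.
have a0 : a != 0 by rewrite numq_eq0.
have c0 : c != 0 by rewrite numq_eq0.
rewrite addf_div ?intr_eq0 // -!intrM -intrD => xy0.
have s0 : a * d + c * b != 0.
  by apply: contraNneq xy0 => ->; rewrite mul0r.
rewrite !padic_val_frac ?mulf_neq0 // abszM lognM ?absz_gt0 // ge_min.
have key (k : nat) (m n : int) : m + n != 0 -> (l ^ k %| `|m|)%N ->
    (l ^ k %| `|n|)%N -> (k <= logn l (absz (m + n)%R))%N.
  move=> mn0 km kn; rewrite -pfactor_dvdn ?absz_gt0 //.
  have : ((l ^ k)%N%:Z %| m + n)%Z by apply: rpredD; rewrite /= dvdzE.
  by rewrite dvdzE.
have [le|lt] := leqP (logn l (absz (a * d))) (logn l (absz (c * b))).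
  have := key (logn l (absz (a * d))) _ _ s0 (pfactor_dvdnn _ _).
  rewrite pfactor_dvdn ?absz_gt0 ?mulf_neq0 // => /(_ le) H.
  apply/orP; left; rewrite -(lerD2r ((logn l `|b|)%:Z + (logn l `|d|)%:Z)).
  rewrite PoszD subrK addrA subrK -PoszD lez_nat.
  by rewrite abszM lognM ?absz_gt0 // in H.
have := key (logn l (absz (c * b))) (a * d) _ s0 _ (pfactor_dvdnn _ _).
rewrite pfactor_dvdn ?absz_gt0 ?mulf_neq0 // => /(_ (ltnW lt)) H.
apply/orP; right; rewrite -(lerD2r ((logn l `|b|)%:Z + (logn l `|d|)%:Z)).
rewrite PoszD subrK addrCA subrK addrC -PoszD lez_nat.
by rewrite abszM lognM ?absz_gt0 // in H.
Qed.

Lemma padic_abs_add x y e : padic_abs x <= e -> padic_abs y <= e ->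
  padic_abs (x + y) <= e.
Proof.
have [->|x0] := eqVneq x 0; first by rewrite add0r.
have [->|y0] := eqVneq y 0; first by rewrite addr0.
have [->|xy0] := eqVneq (x + y) 0.
  by move=> xe _; rewrite padic_abs0 (le_trans (padic_abs_ge0 x)).
have := padic_val_add x0 y0 xy0.
rewrite /padic_abs (negPf x0) (negPf y0) (negPf xy0) ge_min => /orP[] h xe ye.
  by apply: le_trans xe; rewrite ler_weXz2l ?lerN2 // ltW.
by apply: le_trans ye; rewrite ler_weXz2l ?lerN2 // ltW.
Qed.

Lemma padic_abs_addlt x y e : padic_abs x < e -> padic_abs y < e ->
  padic_abs (x + y) < e.
Proof.
move=> xe ye; apply: (@le_lt_trans _ _ (Num.max (padic_abs x) (padic_abs y))).
  by apply: padic_abs_add; rewrite le_max lexx ?orbT.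
by rewrite gt_max xe.
Qed.

End PadicAbs.

Section Padic.
Variables (l : nat) (pr : prime l).
Local Notation abs := (padic_abs l).

Definition padic_cauchy (u : nat -> rat) : bool :=
  `[< forall e, 0 < e ->
      exists N, forall m n, (N <= m)%N -> (N <= n)%N -> abs (u m - u n) < e >].

Definition padic_null (u : nat -> rat) : bool :=
  `[< forall e, 0 < e -> exists N, forall n, (N <= n)%N -> abs (u n) < e >].

(* The primality proof is a parameter so that the closure properties below,
   which need it, can be attached to the predicate. *)
Definition cauchy_pred of prime l := padic_cauchy.

Lemma cauchy_bounded u : padic_cauchy u ->
  exists2 B, 0 < B & forall n, abs (u n) <= B.
Proof.
move=> /asboolP /(_ 1 ltr01)[N hN].
pose B := 1 + \sum_(i < N.+1) abs (u i).
have s0 (k : nat) : 0 <= \sum_(i < k) abs (u i).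
  by apply: sumr_ge0 => i _; exact: padic_abs_ge0.
have B0 : 0 < B by rewrite ltr_wpDr.
have small i : (i <= N)%N -> abs (u i) <= B.
  rewrite -ltnS => iN; rewrite /B (bigD1 (Ordinal iN)) //= addrCA lerDl.
  by rewrite addr_ge0 // sumr_ge0 // => j _; exact: padic_abs_ge0.
exists B => // n; have [/ltnW/small//|Nn] := ltnP n N.
rewrite -(subrK (u N) (u n)); apply: padic_abs_add => //; last exact: small.
by apply/ltW/(lt_le_trans (hN _ _ Nn (leqnn _))); rewrite lerDl.
Qed.

Lemma cauchy_subring : GRing.subring_closed (cauchy_pred pr).
Proof.
split => [|u v|u v].
- apply/asboolP => e e0; exists 0%N => m n _ _.
  by rewrite [X in abs X](_ : _ = 0) ?padic_abs0 // subrr.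
- move=> /asboolP hu /asboolP hv; apply/asboolP => e e0.
  have [N hN] := hu e e0; have [M hM] := hv e e0.
  exists (maxn N M) => m n; rewrite !geq_max => /andP[Nm Mm] /andP[Nn Mn].
  rewrite [X in abs X](_ : _ = (u m - u n) - (v m - v n)); last first.
    rewrite (_ : (u - v) m - (u - v) n = u m - v m - (u n - v n)) //; ring.
  by apply: padic_abs_addlt; rewrite ?padic_absN //; [exact: hN|exact: hM].
- move=> hu hv.
  have [B B0 hB] := cauchy_bounded hu; have [C C0 hC] := cauchy_bounded hv.
  move/asboolP: hu => hu; move/asboolP: hv => hv; apply/asboolP => e e0.
  have [N hN] := hu (e / C) (divr_gt0 e0 C0).
  have [M hM] := hv (e / B) (divr_gt0 e0 B0).
  exists (maxn N M) => m n; rewrite !geq_max => /andP[Nm Mm] /andP[Nn Mn].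
  rewrite [X in abs X](_ : _ = (u m - u n) * v m + u n * (v m - v n)); last first.
    by rewrite mulrBl mulrBr addrA subrK.
  apply: padic_abs_addlt => //; rewrite padic_absM //.
    apply: (@le_lt_trans _ _ (abs (u m - u n) * C)).
      by rewrite ler_wpM2l ?padic_abs_ge0.
    by rewrite -ltr_pdivlMr // hN.
  apply: (@le_lt_trans _ _ (B * abs (v m - v n))).
    by rewrite ler_wpM2r ?padic_abs_ge0.
  by rewrite mulrC -ltr_pdivlMr // hM.
Qed.

HB.instance Definition _ :=
  GRing.isSubringClosed.Build (nat -> rat) (cauchy_pred pr) cauchy_subring.

Record cauchy_seq := CauchySeq {
  cauchy_val :> nat -> rat; cauchy_valP : cauchy_pred pr cauchy_val }.

HB.instance Definition _ := [isSub for cauchy_val].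
HB.instance Definition _ := [Choice of cauchy_seq by <:].
HB.instance Definition _ := [SubChoice_isSubComNzRing of cauchy_seq by <:].

Definition null_ideal : {pred cauchy_seq} := fun u => padic_null u.

Lemma null_idealr_closed : idealr_closed null_ideal.
Proof.
split.
- apply/asboolP => e e0; exists 0%N => n _.
  by rewrite padic_abs0.
- apply/negP => /asboolP /(_ 1 ltr01)[N /(_ _ (leqnn N))].
  by rewrite padic_abs1 ltxx.
- move=> a u v /asboolP hu /asboolP hv; apply/asboolP => e e0.
  have [B B0 hB] := cauchy_bounded (cauchy_valP a).
  have [N hN] := hu (e / B) (divr_gt0 e0 B0); have [M hM] := hv e e0.
  exists (maxn N M) => n; rewrite !geq_max => /andP[Nn Mn].
  rewrite [X in abs X](_ : _ = a n * u n + v n) //.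
  apply: padic_abs_addlt => //; last exact: hM.
  rewrite padic_absM //; apply: (@le_lt_trans _ _ (B * abs (u n))).
    by rewrite ler_wpM2r ?padic_abs_ge0.
  by rewrite mulrC -ltr_pdivlMr // hN.
Qed.

HB.instance Definition _ :=
  isIdealr.Build cauchy_seq null_ideal null_idealr_closed.

(* Q_l as the completion of rat: Cauchy sequences for the l-adic absolute value
   modulo null sequences. *)
Definition padic := {ideal_quot null_ideal}.
HB.instance Definition _ := GRing.ComNzRing.on padic.

Definition padic_lim (u : cauchy_seq) : padic := \pi_({ideal_quot null_ideal}) u.
Definition padic_repr (x : padic) : cauchy_seq := repr x.

Lemma padic_reprK : cancel padic_repr padic_lim.
Proof. exact: reprK. Qed.

Lemma padic_lim_is_zmod_morphism : zmod_morphism padic_lim.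
Proof. exact: rmorphB. Qed.

Lemma padic_lim_is_monoid_morphism : monoid_morphism padic_lim.
Proof. by split; [exact: rmorph1 | exact: rmorphM]. Qed.

HB.instance Definition _ :=
  GRing.isZmodMorphism.Build cauchy_seq padic padic_lim
    padic_lim_is_zmod_morphism.
HB.instance Definition _ :=
  GRing.isMonoidMorphism.Build cauchy_seq padic padic_lim
    padic_lim_is_monoid_morphism.

Lemma padic_lim_eq (u v : cauchy_seq) :
  (padic_lim u == padic_lim v) = padic_null (u - v).
Proof. by rewrite -Quotient.idealrBE. Qed.

Lemma padic_lim_eq0 (u : cauchy_seq) : (padic_lim u == 0) = padic_null u.
Proof. by rewrite -(rmorph0 padic_lim) padic_lim_eq subr0. Qed.

Lemma padic_abs_isosceles (x y : rat) : abs (x - y) < abs y -> abs x = abs y.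
Proof.
move=> h; apply/eqP; rewrite eq_le; apply/andP; split.
  by rewrite -(subrK y x); apply: padic_abs_add => //; exact: ltW.
rewrite leNgt; apply/negP => xy.
have : abs ((y - x) + x) < abs y.
  by apply: padic_abs_addlt => //; rewrite padic_absB.
by rewrite subrK ltxx.
Qed.

Lemma cauchy_abs_eventually_cst (u : nat -> rat) : padic_cauchy u ->
  ~~ padic_null u ->
  exists2 c, 0 < c & exists N, forall n, (N <= n)%N -> abs (u n) = c.
Proof.
move=> /asboolP hu /asboolPn; rewrite -existsNE => -[e] /not_implyP[e0 he].
have [N hN] := hu e e0.
have [n0 Nn0 n0e] : exists2 n, (N <= n)%N & e <= abs (u n).
  apply: contrapT => h; apply: he; exists N => n Nn; rewrite ltNge.
  by apply/negP => en; apply: h; exists n.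
exists (abs (u n0)); first exact: lt_le_trans n0e.
exists N => n Nn; apply: padic_abs_isosceles.
by apply: lt_le_trans n0e; exact: hN.
Qed.

Definition inv_cauchy (u : cauchy_seq) : cauchy_seq :=
  insubd u (fun n => (u n)^-1).

Definition padic_inv (x : padic) : padic :=
  if x == 0 then 0 else padic_lim (inv_cauchy (padic_repr x)).

Lemma padic_mulVf x : x != 0 -> padic_inv x * x = 1.
Proof.
move=> x0; rewrite /padic_inv (negPf x0).
have unn : ~~ padic_null (padic_repr x).
  by rewrite -padic_lim_eq0 padic_reprK.
have [c c0 [N hN]] := cauchy_abs_eventually_cst (cauchy_valP (padic_repr x)) unn.
have uN0 n : (N <= n)%N -> padic_repr x n != 0.
  by move=> /hN; apply: contra_eq_neq => ->; rewrite padic_abs0 lt_eqF.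
have wC : cauchy_pred pr (fun n => (padic_repr x n)^-1).
  have /asboolP hu := cauchy_valP (padic_repr x).
  apply/asboolP => e e0.
  have [M hM] := hu (e * (c * c)) (mulr_gt0 e0 (mulr_gt0 c0 c0)).
  exists (maxn N M) => m n; rewrite !geq_max => /andP[Nm Mm] /andP[Nn Mn].
  rewrite (_ : _ - _ = (padic_repr x n - padic_repr x m) / (padic_repr x m * padic_repr x n)); last first.
    by field; rewrite !uN0.
  rewrite padic_absM // padic_absV // padic_absM // !hN //.
  by rewrite ltr_pdivrMr ?mulr_gt0 // hM.
rewrite -[x in _ * x]padic_reprK -rmorphM -(rmorph1 padic_lim); apply/eqP.
rewrite padic_lim_eq.
apply/asboolP => e e0; exists N => n Nn.
rewrite [X in abs X](_ : _ = 0) ?padic_abs0 //.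
rewrite [LHS](_ : _ = inv_cauchy (padic_repr x) n * padic_repr x n - 1) //.
by rewrite /inv_cauchy /insubd insubT /= mulVf ?subrr ?uN0.
Qed.

Lemma padic_inv0 : padic_inv 0 = 0.
Proof. by rewrite /padic_inv eqxx. Qed.

HB.instance Definition _ :=
  GRing.ComNzRing_isField.Build padic padic_mulVf padic_inv0.


Lemma cauchy_cst q : cauchy_pred pr (fun=> q).
Proof.
by apply/asboolP => e e0; exists 0%N => m n _ _; rewrite subrr padic_abs0.
Qed.

Definition padic_of_rat (q : rat) : padic := padic_lim (CauchySeq (cauchy_cst q)).

Lemma padic_of_rat_is_zmod_morphism : zmod_morphism padic_of_rat.
Proof.
by move=> x y; rewrite /padic_of_rat -rmorphB; congr padic_lim; exact: val_inj.
Qed.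

Lemma padic_of_rat_is_monoid_morphism : monoid_morphism padic_of_rat.
Proof.
split=> [|x y]; rewrite /padic_of_rat.
  by rewrite -(rmorph1 padic_lim); congr padic_lim; exact: val_inj.
by rewrite -rmorphM; congr padic_lim; exact: val_inj.
Qed.

HB.instance Definition _ :=
  GRing.isZmodMorphism.Build rat padic padic_of_rat
    padic_of_rat_is_zmod_morphism.
HB.instance Definition _ :=
  GRing.isMonoidMorphism.Build rat padic padic_of_rat
    padic_of_rat_is_monoid_morphism.

(* The absolute values of a non-null Cauchy sequence are eventually constant, so
   the extended absolute value still takes rational values; see padic_normP.
   The default value 0 of xget is used only for x = 0. *)
Definition padic_norm (x : padic) : rat :=
  xget 0 [set c | exists N, forall n, (N <= n)%N -> abs (padic_repr x n) = c].

Lemma padic_norm0 : padic_norm 0 = 0.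
Proof.
rewrite /padic_norm; case: xgetP => // c _ [N hN].
have : padic_null (padic_repr 0) by rewrite -padic_lim_eq0 padic_reprK.
move=> /asboolP hu; have c0 : 0 <= c by rewrite -(hN N) ?padic_abs_ge0.
apply/eqP; rewrite eq_le c0 andbT leNgt; apply/negP => /hu [M hM].
by have := hM _ (leq_maxr N M); rewrite hN ?leq_maxl // ltxx.
Qed.

Lemma padic_norm_lim (u : cauchy_seq) c N :
  (forall n, (N <= n)%N -> abs (u n) = c) -> padic_norm (padic_lim u) = c.
Proof.
move=> hN; have [|un] := boolP (padic_null u).
  move=> /[dup] un /asboolP hu.
  have /eqP -> : padic_lim u == 0 by rewrite padic_lim_eq0.
  rewrite padic_norm0; have c0 : 0 <= c by rewrite -(hN N) ?padic_abs_ge0.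
  apply/eqP; rewrite eq_le c0 leNgt; apply/negP => /hu [M hM].
  by have := hM _ (leq_maxr N M); rewrite hN ?leq_maxl // ltxx.
have c0 : 0 < c.
  rewrite -(hN N) // padic_abs_gt0 //; apply: contra un => /eqP uN0.
  have c0 : c = 0 by rewrite -(hN N) // uN0 padic_abs0.
  by apply/asboolP => e e0; exists N => n /hN ->; rewrite c0.
have : padic_null (padic_repr (padic_lim u) - u).
  by rewrite -padic_lim_eq padic_reprK.
move=> /asboolP /(_ c c0)[M hM].
have key n : (maxn N M <= n)%N -> abs (padic_repr (padic_lim u) n) = c.
  rewrite geq_max => /andP[Nn Mn]; rewrite -(hN n) //.
  by apply: padic_abs_isosceles; rewrite hN //; exact: hM.
rewrite /padic_norm; case: xgetP => [d _ [K hK]|/(_ c)[]]; last by exists (maxn N M).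
by rewrite -(hK (maxn K (maxn N M))) ?leq_maxl // key // leq_maxr.
Qed.

Lemma padic_norm_of_rat q : padic_norm (padic_of_rat q) = abs q.
Proof. exact: (@padic_norm_lim _ _ 0). Qed.

Lemma padic_normP x : x != 0 ->
  exists N, forall n, (N <= n)%N -> abs (padic_repr x n) = padic_norm x.
Proof.
move=> x0; have unn : ~~ padic_null (padic_repr x).
  by rewrite -padic_lim_eq0 padic_reprK.
have [c c0 [N hN]] := cauchy_abs_eventually_cst (cauchy_valP (padic_repr x)) unn.
by exists N => n Nn; rewrite -{2}[x]padic_reprK (padic_norm_lim hN) hN //.
Qed.

Lemma padic_norm_ge0 x : 0 <= padic_norm x.
Proof.
have [->|x0] := eqVneq x 0; first by rewrite padic_norm0.
by have [N hN] := padic_normP x0; rewrite -(hN N) // padic_abs_ge0.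
Qed.

Lemma padic_norm_eq0 x : (padic_norm x == 0) = (x == 0).
Proof.
have [->|x0] := eqVneq x 0; first by rewrite padic_norm0 eqxx.
have [N hN] := padic_normP x0; apply: contra_neqF x0 => /eqP n0; apply/eqP.
rewrite -[x]padic_reprK padic_lim_eq0.
by apply/asboolP => e e0; exists N => n /hN ->; rewrite n0.
Qed.

Lemma padic_normM x y : padic_norm (x * y) = padic_norm x * padic_norm y.
Proof.
have [->|x0] := eqVneq x 0; first by rewrite mul0r padic_norm0 mul0r.
have [->|y0] := eqVneq y 0; first by rewrite mulr0 padic_norm0 mulr0.
have [N hN] := padic_normP x0; have [M hM] := padic_normP y0.
rewrite -{1}[x]padic_reprK -{1}[y]padic_reprK -rmorphM.
apply: (@padic_norm_lim _ _ (maxn N M)) => n; rewrite geq_max => /andP[Nn Mn].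
rewrite -(hN n) // -(hM n) // -padic_absM //.
Qed.

Lemma padic_norm_addlt x y e : padic_norm x < e -> padic_norm y < e ->
  padic_norm (x + y) < e.
Proof.
have [->|x0] := eqVneq x 0; first by rewrite add0r.
have [->|y0] := eqVneq y 0; first by rewrite addr0.
have [->|s0] := eqVneq (x + y) 0.
  by rewrite padic_norm0 => h _; apply: le_lt_trans h; exact: padic_norm_ge0.
have [N hN] := padic_normP x0; have [M hM] := padic_normP y0.
have [K hK] := padic_normP s0; move=> hx hy.
have : padic_null (padic_repr (x + y) - (padic_repr x + padic_repr y)).
  by rewrite -padic_lim_eq rmorphD /= !padic_reprK.
have e0 : 0 < e by apply: le_lt_trans hx; exact: padic_norm_ge0.
move=> /asboolP/(_ e e0)[L hL].
pose n := maxn (maxn N M) (maxn K L).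
have [Nn Mn] : (N <= n)%N /\ (M <= n)%N.
  by rewrite /n; split; rewrite !leq_max leqnn ?orbT.
have [Kn Ln] : (K <= n)%N /\ (L <= n)%N.
  by rewrite /n; split; rewrite !leq_max leqnn ?orbT.
rewrite -(hK n) //.
rewrite -(subrK (padic_repr x n + padic_repr y n) (padic_repr (x + y) n)).
apply: padic_abs_addlt => //; first exact: hL.
by apply: padic_abs_addlt; rewrite // ?hN ?hM.
Qed.

Lemma padic_normN x : padic_norm (- x) = padic_norm x.
Proof.
by rewrite -mulN1r padic_normM -(rmorphN1 padic_of_rat) padic_norm_of_rat
  padic_absN padic_abs1 mul1r.
Qed.

Lemma padic_dense x e : 0 < e -> exists q, padic_norm (x - padic_of_rat q) < e.
Proof.
move=> e0; have /asboolP/(_ e e0)[N hN] := cauchy_valP (padic_repr x).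
exists (padic_repr x N); rewrite -{1}[x]padic_reprK /padic_of_rat -rmorphB /=.
set d := padic_repr x - _.
have [dn|dn] := boolP (padic_null d).
  have /eqP -> : padic_lim d == 0 by rewrite padic_lim_eq0.
  by rewrite padic_norm0.
have [c c0 [M hM]] := cauchy_abs_eventually_cst (cauchy_valP d) dn.
rewrite (padic_norm_lim hM) -(hM (maxn N M)) ?leq_maxr //.
by apply: hN; rewrite ?leq_maxl.
Qed.


(* Membership in Z[1/l]. *)
Definition in_Zinv (a : rat) := exists (m : int) (k : nat), a = m%:~R / l%:R ^+ k.

Definition is_padic_floor (x : padic) (a : rat) :=
  [/\ in_Zinv a, 0 <= a < l%:R & padic_norm (x - padic_of_rat a) < 1].

Let l_gt0 : 0 < l%:R :> rat.
Proof. by rewrite ltr0n prime_gt0. Qed.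

Lemma padic_abs_nat (m : nat) : (0 < m)%N -> abs m%:R = l%:R ^- logn l m.
Proof.
move=> m0; rewrite /padic_abs pnatr_eq0.
rewrite (negPf (lt0n_neq0 m0)) [m%:R]pmulrn /padic_val numq_int denq_int logn1 subr0.
by rewrite exprnN.
Qed.

Lemma padic_abs_int (m : int) : abs m%:~R = abs `|m|%:R.
Proof.
by case: m => n //; rewrite NegzE rmorphN padic_absN abszN.
Qed.

Lemma padic_abs_lt_dvd (m : int) k : abs m%:~R < l%:R ^- k ->
  (l ^ k.+1 %| `|m|)%N.
Proof.
have [->|m0] := eqVneq m 0; first by rewrite dvdn0.
rewrite padic_abs_int padic_abs_nat ?absz_gt0 //.
rewrite ltf_pV2 ?posrE ?exprn_gt0 // ltr_eXn2l ?ltr1n ?prime_gt1 //.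
by rewrite pfactor_dvdn // absz_gt0.
Qed.

Lemma padic_dvd_abs_lt (m : int) k : (l ^ k.+1 %| `|m|)%N ->
  abs m%:~R < l%:R ^- k.
Proof.
have [->|m0] := eqVneq m 0; first by rewrite padic_abs0 invr_gt0 exprn_gt0.
rewrite padic_abs_int padic_abs_nat ?absz_gt0 //.
rewrite ltf_pV2 ?posrE ?exprn_gt0 // ltr_eXn2l ?ltr1n ?prime_gt1 //.
by rewrite pfactor_dvdn // absz_gt0.
Qed.

Lemma padic_absX k : abs (l%:R ^+ k) = l%:R ^- k.
Proof. by rewrite -[in LHS]natrX padic_abs_nat ?expn_gt0 ?prime_gt0 // pfactorK. Qed.

Lemma padic_floor_unique x a b :
  is_padic_floor x a -> is_padic_floor x b -> a = b.
Proof.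
move=> [[m [k aE]] /andP[a0 al] xa] [[n [j bE]] /andP[b0 bl] xb].
have ab : abs (a - b) < 1.
  rewrite -(padic_norm_of_rat (a - b)) rmorphB /=.
  rewrite (_ : _ - _ = - (x - padic_of_rat a) + (x - padic_of_rat b)); last by ring.
  by apply: padic_norm_addlt; rewrite ?padic_normN.
pose c : int := m * (l ^ j)%N%:Z - n * (l ^ k)%N%:Z.
have cE : c%:~R = (a - b) * l%:R ^+ (k + j).
  rewrite /c intrB !intrM -!pmulrn !natrX exprD aE bE.
  by field; rewrite !expf_neq0 ?lt0r_neq0.
have L0 : 0 < l%:R ^+ (k + j) :> rat by rewrite exprn_gt0.
have cdvd : (l ^ (k + j).+1 %| `|c|)%N.
  apply: padic_abs_lt_dvd; rewrite cE padic_absM // padic_absX.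
  by rewrite gtr_pMl // invr_gt0.
have clt : (`|c| < l ^ (k + j).+1)%N.
  rewrite -(ltr_nat rat) natrX exprS -[X in X < _]/(`|c|%N%:~R) abszE.
  rewrite intr_norm cE normrM (gtr0_norm L0) ltr_pM2r // ltr_norml.
  apply/andP; split; last by rewrite (le_lt_trans _ al) // gerBl.
  by rewrite ltrBrDr addrC (lt_le_trans _ a0) // subr_lt0.
have /eqP c0 : c == 0.
  by rewrite -absz_eq0 -leqn0 leqNgt; apply/negP => /dvdn_leq/(_ cdvd); rewrite leqNgt clt.
move/eqP: cE; rewrite c0 mulr0z eq_sym mulf_eq0 (gt_eqF L0) orbF subr_eq0.
by move/eqP.
Qed.

Lemma padic_floor_rat_exists q : exists a, is_padic_floor (padic_of_rat q) a.
Proof.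
pose d := `|denq q|%N; have d0 : (0 < d)%N by rewrite absz_gt0 denq_neq0.
pose k := logn l d; pose d' := (d`_(l^'))%N.
have dE : d = (l ^ k * d')%N by rewrite -p_part partnC.
have cop : coprime d' (l ^ k.+1) by rewrite coprime_sym coprimeXl // prime_coprime // -p'natE // part_pnat.
have d'0 : (0 < d')%N by rewrite part_gt0.
have /coprimezP[[u v] /= uv] : coprimez d'%:Z (l ^ k.+1)%N%:Z by rewrite coprimezE.
pose L : int := (l ^ k.+1)%N%:Z.
have L0 : 0 < L by rewrite ltz_nat expn_gt0 prime_gt0.
pose c : int := (numq q * u %% L)%Z.
have lk0 : 0 < l%:R ^+ k :> rat by rewrite exprn_gt0.
have qE : q = (numq q)%:~R / (l%:R ^+ k * d'%:R).
  rewrite -{1}[q]divq_num_den; congr (_ / _).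
  by rewrite -natrX -natrM -dE /d -[LHS]gtr0_norm ?ltr0z ?denq_gt0 // -intr_norm -abszE.
exists (c%:~R / l%:R ^+ k); split; first by exists c, k.
  apply/andP; split; first by rewrite divr_ge0 ?(ltW lk0) // ler0z modz_ge0 // gt_eqF.
  rewrite ltr_pdivrMr // -exprS -natrX.
  by rewrite (_ : (l ^ k.+1)%:R = L%:~R) // ltr_int ltz_pmod.
rewrite -rmorphB padic_norm_of_rat.
have E : numq q - c * d'%:Z = L * (numq q * v + (numq q * u %/ L)%Z * d'%:Z).
  have h := divz_eq (numq q * u) L.
  have {1}-> : numq q = numq q * (u * d'%:Z + v * L) by rewrite uv mulr1.
  rewrite mulrDr mulrA {1}h -/c; ring.
rewrite [X in abs X](_ : _ = (numq q - c * d'%:Z)%:~R / l%:R ^+ k / d'%:R); last first.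
  rewrite {1}qE intrB intrM -pmulrn; field.
  by rewrite pnatr_eq0 -lt0n d'0 expf_neq0 ?lt0r_neq0.
rewrite !padic_absM // !padic_absV // padic_absX (padic_abs_nat d'0).
rewrite (_ : logn l d' = 0%N); last first.
  by apply/eqP; rewrite -leqn0 leqNgt -(pfactor_dvdn 1) // expn1 -prime_coprime // -(@coprime_pexpl k.+1) // coprime_sym.
rewrite expr0 !invr1 mulr1 invrK -ltr_pdivlMr // div1r padic_dvd_abs_lt //.
by rewrite E abszM dvdn_mulr.
Qed.

Lemma padic_floor_exists x : exists a, is_padic_floor x a.
Proof.
have [q xq] := padic_dense x ltr01.
have [a [aZ a0 qa]] := padic_floor_rat_exists q; exists a; split => //.
rewrite (_ : x - _ = (x - padic_of_rat q) + (padic_of_rat q - padic_of_rat a)).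
  exact: padic_norm_addlt.
by rewrite addrA subrK.
Qed.

(* The floor is the unique a such that is_padic_floor x a: see padic_floorP and
   padic_floor_unique. *)
Definition padic_floor (x : padic) : rat := xget 0 [set a | is_padic_floor x a].

Lemma padic_floorP x : is_padic_floor x (padic_floor x).
Proof.
by rewrite /padic_floor; case: xgetP => [//|/=]; have [a /[swap]/(_ a)] := padic_floor_exists x.
Qed.

End Padic.

Section Ruban.
Variables (l : nat) (pr : prime l).
Implicit Types (x : padic pr) (n N p : nat) (s : seq rat).

(* [complete_quotient x n] is None when the expansion stops before step n. *)
Fixpoint complete_quotient x n : option (padic pr) :=
  if n is n'.+1 then
    if complete_quotient x n' is Some y then
      let r := y - padic_of_rat pr (padic_floor y) in
      if r == 0 then None else Some (1 / r)
    else None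
  else Some x.

Definition partial_quotient x n : option rat :=
  omap (@padic_floor l pr) (complete_quotient x n).

Definition rcf_terminates x := exists n, complete_quotient x n = None.

(* The sign of an element of Q_l is meaningful only when it is rational. *)
Definition padic_nonneg (y : padic pr) :=
  exists2 q : rat, y = padic_of_rat pr q & 0 <= q.

Definition complete_quotients_nonneg x :=
  forall n y, complete_quotient x n = Some y -> padic_nonneg y.

Definition rcf_periodic_from x N :=
  exists2 p, (0 < p)%N &
    forall n, (N <= n)%N -> partial_quotient x (n + p) = partial_quotient x n.

Definition rcf_periodic x :=
  ~ rcf_terminates x /\ exists N, rcf_periodic_from x N.

(* The pre-periodic part is the shortest prefix after which the expansion is
   purely periodic. *)
Definition rcf_preperiod x s :=
  [/\ map Some s = map (partial_quotient x) (iota 0 (size s)),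
      rcf_periodic_from x (size s)
    & forall N, rcf_periodic_from x N -> (size s <= N)%N].

End Ruban.

(* The total recursive functions: minimisation is only applied to functions
   that have a zero for every value of the parameters.  This is an inductive
   predicate on functions; recursive_ext closes it under pointwise equality. *)
Inductive recursive : forall n, (n.-tuple nat -> nat) -> Prop :=
| recursive_zero n : @recursive n (fun=> 0%N)
| recursive_succ : @recursive 1 (fun v => (thead v).+1)
| recursive_proj n (i : 'I_n) : @recursive n (fun v => tnth v i)
| recursive_comp m n (f : m.-tuple nat -> nat) (g : 'I_m -> n.-tuple nat -> nat) :
    recursive f -> (forall i, recursive (g i)) ->
    @recursive n (fun v => f [tuple g i v | i < m])
| recursive_primrec n (f : n.-tuple nat -> nat) (g : n.+2.-tuple nat -> nat) :
    recursive f -> recursive g ->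
    @recursive n.+1 (fun v =>
      iteri (thead v) (fun k r => g [tuple of k :: r :: behead v])
        (f [tuple of behead v]))
| recursive_mu n (g : n.+1.-tuple nat -> nat)
    (reg : forall v : n.-tuple nat, exists y, g [tuple of y :: v] == 0%N) :
    recursive g -> @recursive n (fun v => ex_minn (reg v))
| recursive_ext n (f g : n.-tuple nat -> nat) :
    f =1 g -> recursive f -> recursive g.

(* A rational number as sign bit, absolute value of the numerator, denominator. *)
Definition rat_code (q : rat) : 3.-tuple nat :=
  [tuple nat_of_bool (q < 0); `|numq q|%N; `|denq q|%N].

Definition rat_seq_code (s : seq rat) : nat :=
  CodeSeq.code (flatten [seq tval (rat_code q) | q <- s]).

(* Main.v *)
Require Import Defs.
From mathcomp Require Import all_boot all_order all_algebra.
From mathcomp Require Import boolp.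
From mathcomp Require Import ring zify.
Import Order.TTheory GRing.Theory Num.Theory.

(** The expansion of a rational x is the orbit of x under the map
    T y = (y - floor y)^-1 on the rationals, where 0^-1 = 0 makes 0 an absorbing
    state that stands for termination ([complete_quotient_of_rat]).

    Write y = u / (l^e w) with w prime to l.  Its floor is c / l^e with
    0 <= c < L = l^(e+1), where u - c w = L t for an integer t, and
    T y = w / (l t) ([ruban_map_frac]).  Splitting off the powers of l in t, the
    next term is w / (l^e' w') up to the sign of t, with w' <= |t|.  So the old
    w becomes the new numerator, and one must compare |t| with |u| and w.

    - If u < 0 then |t| L = |u| + c w <= |u| + (L - 1) w, so |t| is at most a
      weighted mean of |u| and w, hence below max (|u|, w) unless |u| = w.  So
      this maximum drops within two steps unless |u| = w, that is y = -1/l^e;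
      and T (-1/l^e) = -1/l is a fixed point of T, with floor l - 1/l.
    - If u >= 0 then either t < 0 and the orbit has become negative, or
      t <= u / L < u and |u| + w drops, or t = 0 and the orbit has reached 0.

    So the orbit is at 0 or at -1/l after a number of steps that is linear in
    the height of x ([settled_iter]).  Floors being non-negative, T maps
    negative numbers to negative numbers: an orbit that meets a negative number
    never terminates, and one that does not cannot end at -1/l.  This is (i), and
    the value l - 1/l of the floor at -1/l gives (ii).  The minimal pre-period ends
    exactly where the orbit first meets -1/l: from T y = -1/l and
    floor y = l - 1/l one recovers y = -1/l ([rcf_periodic_fromP]).

    For the algorithms, the explicit bound on the number of steps removes any
    unbounded search: T is computed on codes of fractions that are not reduced,
    the floor being found by trying all numerators c in turn ([decode_step]). *)

Set Implicit Arguments.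
Unset Strict Implicit.
Unset Printing Implicit Defensive.

(** * Closure properties of recursive functions *)

(** Bounded minimisation is expressed throughout as a [find] on an initial
    segment; its value on failure is the bound itself. *)
Lemma find_iota (p : pred nat) b m : m <= b ->
  (forall y, y < m -> p y = false) -> (m < b -> p m) -> find p (iota 0 b) = m.
Proof.
move=> mb small pm; rewrite -(subnKC mb) iotaD find_cat size_iota.
rewrite (_ : has p (iota 0 m) = false); last first.
  by apply/hasP => -[y]; rewrite mem_iota /= => /small ->.
case: (ltnP m b) => [lt|le]; last by rewrite (eqP le) addn0.
by rewrite -[b - m]prednK ?subn_gt0 //= pm ?addn0.
Qed.

Lemma recursive_comp1 n (f : 1.-tuple nat -> nat) (g : n.-tuple nat -> nat) :
  recursive f -> recursive g -> recursive (fun v => f [tuple g v]).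
Proof.
move=> rf rg; apply: recursive_ext (recursive_comp (g := fun=> g) rf (fun=> rg)).
by move=> v; congr f; apply: eq_from_tnth => i; rewrite tnth_mktuple ord1.
Qed.

Lemma recursive_const n c : recursive (fun _ : n.-tuple nat => c).
Proof.
elim: c => [|c IH]; first exact: recursive_zero.
apply: recursive_ext (recursive_comp1 recursive_succ IH).
by [].
Qed.

Lemma recursive_S n (f : n.-tuple nat -> nat) :
  recursive f -> recursive (fun v => (f v).+1).
Proof.
by move=> rf; apply: recursive_ext (recursive_comp1 recursive_succ rf).
Qed.

Lemma recursive_behead n (f : n.-tuple nat -> nat) :
  recursive f -> recursive (fun w : n.+1.-tuple nat => f [tuple of behead w]).
Proof.
move=> rf; apply: recursive_ext (recursive_comp
  (g := fun i (w : n.+1.-tuple nat) => tnth w (lift ord0 i)) rf _) => [w|i].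
  by congr f; apply: eq_from_tnth => i; rewrite tnth_mktuple tnth_behead;
    congr tnth; apply: val_inj; rewrite /= inordK ?ltnS.
exact: recursive_proj.
Qed.

Lemma recursive_thead n : recursive (fun w : n.+1.-tuple nat => thead w).
Proof. exact: recursive_proj. Qed.

Lemma recursive_behead2 n (f : n.-tuple nat -> nat) : recursive f ->
  recursive (fun w : n.+2.-tuple nat =>
    f [tuple of behead [tuple of behead w]]).
Proof. by move/recursive_behead/recursive_behead. Qed.

Lemma recursive_thead1 n :
  recursive (fun w : n.+2.-tuple nat => thead [tuple of behead w]).
Proof. exact: recursive_behead (recursive_thead n). Qed.

(** The closure lemmas are stated for functions of a tuple v of parameters, so
    that they compose without projections.  Under a binder the environment grows
    at the front, and v becomes a tail. *)
Lemma recursive_iteri n (G : nat -> nat -> n.-tuple nat -> nat)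
    (b f : n.-tuple nat -> nat) :
    recursive (fun w : n.+2.-tuple nat =>
      G (thead w) (thead [tuple of behead w])
        [tuple of behead [tuple of behead w]]) ->
    recursive b -> recursive f ->
  recursive (fun v => iteri (b v) (fun k r => G k r v) (f v)).
Proof.
move=> rG rb rf.
pose h i (v : n.-tuple nat) := tnth [tuple of b v :: v] i.
have rh i : recursive (h i).
  have [j|] := unliftP ord0 i => ->; last first.
    by apply: recursive_ext rb => v; rewrite /h tnth0.
  by apply: recursive_ext (recursive_proj j) => v; rewrite /h tnthS.
apply: recursive_ext (recursive_comp (recursive_primrec rf rG) rh) => v.
have -> : [tuple h i v | i < n.+1] = [tuple of b v :: v].
  by apply: eq_from_tnth => i; rewrite tnth_mktuple.
rewrite theadE /=; congr iteri; last by congr f; exact: val_inj.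
apply/funext => k; apply/funext => r.
by rewrite !theadE; congr G; exact: val_inj.
Qed.

Ltac rec_basic := cbv beta; first
  [ assumption | apply: recursive_const
  | apply: recursive_thead | apply: recursive_thead1
  | apply: recursive_behead; assumption
  | apply: recursive_behead2; assumption
  | apply: recursive_S | apply: recursive_iteri ].

(** A conditional is an iteration of length 0 or 1. *)
Lemma recursive_ifb n (P : n.-tuple nat -> bool) (f g : n.-tuple nat -> nat) :
    recursive (fun v => P v : nat) -> recursive f -> recursive g ->
  recursive (fun v => if P v then f v else g v).
Proof.
move=> rP rf rg; apply: recursive_ext (_ : recursive
    (fun v => iteri (P v) (fun _ _ => f v) (g v))) => [v|]; first by case: (P v).
by repeat rec_basic.
Qed.

Lemma recursive_pred n (f : n.-tuple nat -> nat) :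
  recursive f -> recursive (fun v => (f v).-1).
Proof.
move=> rf; apply: recursive_ext (_ : recursive
    (fun v => iteri (f v) (fun k _ => k) 0)) => [v|]; first by case: (f v).
by repeat rec_basic.
Qed.

Lemma recursive_subn n (f g : n.-tuple nat -> nat) :
  recursive f -> recursive g -> recursive (fun v => f v - g v).
Proof.
move=> rf rg; apply: recursive_ext (_ : recursive
    (fun v => iteri (g v) (fun _ r => r.-1) (f v))) => [v|].
  by elim: (g v) => [|k IH] /=; rewrite ?subn0 // IH subnS.
by repeat first [rec_basic | apply: recursive_pred].
Qed.

Lemma recursive_addn n (f g : n.-tuple nat -> nat) :
  recursive f -> recursive g -> recursive (fun v => f v + g v).
Proof.
move=> rf rg; apply: recursive_ext (_ : recursive
    (fun v => iteri (f v) (fun _ r => r.+1) (g v))) => [v|].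
  by elim: (f v) => [|k IH] //=; rewrite IH.
by repeat rec_basic.
Qed.

Lemma recursive_muln n (f g : n.-tuple nat -> nat) :
  recursive f -> recursive g -> recursive (fun v => f v * g v).
Proof.
move=> rf rg; apply: recursive_ext (_ : recursive
    (fun v => iteri (f v) (fun _ r => g v + r) 0)) => [v|].
  by elim: (f v) => [|k IH] //=; rewrite IH.
by repeat first [rec_basic | apply: recursive_addn].
Qed.

Lemma recursive_expn n (f g : n.-tuple nat -> nat) :
  recursive f -> recursive g -> recursive (fun v => f v ^ g v).
Proof.
move=> rf rg; apply: recursive_ext (_ : recursive
    (fun v => iteri (g v) (fun _ r => f v * r) 1)) => [v|].
  by elim: (g v) => [|k IH] //=; rewrite IH expnS.
by repeat first [rec_basic | apply: recursive_muln].
Qed.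

Lemma recursive_not n (P : n.-tuple nat -> bool) :
  recursive (fun v => P v : nat) -> recursive (fun v => ~~ P v : nat).
Proof.
move=> rP; apply: recursive_ext (_ : recursive
    (fun v => 1 - P v)) => [v|]; first by case: (P v).
by repeat first [rec_basic | apply: recursive_subn].
Qed.

Lemma recursive_and n (P Q : n.-tuple nat -> bool) :
    recursive (fun v => P v : nat) -> recursive (fun v => Q v : nat) ->
  recursive (fun v => P v && Q v : nat).
Proof.
move=> rP rQ; apply: recursive_ext (_ : recursive
    (fun v => P v * Q v)) => [v|]; first by case: (P v); case: (Q v).
by repeat first [rec_basic | apply: recursive_muln].
Qed.

Lemma recursive_or n (P Q : n.-tuple nat -> bool) :
    recursive (fun v => P v : nat) -> recursive (fun v => Q v : nat) ->
  recursive (fun v => P v || Q v : nat).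
Proof.
move=> rP rQ; apply: recursive_ext (_ : recursive
    (fun v => ~~ (~~ P v && ~~ Q v) : nat)) => [v|].
  by case: (P v); case: (Q v).
by repeat first [apply: recursive_not | apply: recursive_and | rec_basic].
Qed.

Lemma recursive_eq0 n (f : n.-tuple nat -> nat) :
  recursive f -> recursive (fun v => f v == 0 : nat).
Proof.
move=> rf; apply: recursive_ext (_ : recursive
    (fun v => 1 - f v)) => [v|]; first by case: (f v).
by repeat first [rec_basic | apply: recursive_subn].
Qed.

Lemma recursive_leq n (f g : n.-tuple nat -> nat) :
  recursive f -> recursive g -> recursive (fun v => f v <= g v : nat).
Proof.
by move=> rf rg; apply: recursive_eq0; exact: recursive_subn.
Qed.

Lemma recursive_eqn n (f g : n.-tuple nat -> nat) :
  recursive f -> recursive g -> recursive (fun v => f v == g v : nat).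
Proof.
move=> rf rg; apply: recursive_ext (_ : recursive
    (fun v => (f v <= g v) && (g v <= f v) : nat)) => [v|].
  by rewrite eqn_leq.
by apply: recursive_and; exact: recursive_leq.
Qed.

(** A bounded search is a regular minimisation once the bound is allowed as a
    witness. *)
Lemma recursive_find n (P : nat -> n.-tuple nat -> bool)
    (b : n.-tuple nat -> nat) :
    recursive (fun w : n.+1.-tuple nat =>
      P (thead w) [tuple of behead w] : nat) ->
    recursive b ->
  recursive (fun v => find (fun y => P y v) (iota 0 (b v))).
Proof.
move=> rP rb.
pose g (w : n.+1.-tuple nat) : nat :=
  ~~ (P (thead w) [tuple of behead w] || (b [tuple of behead w] <= thead w)).
have gE y (v : n.-tuple nat) : (g [tuple of y :: v] == 0) = P y v || (b v <= y).
  rewrite /g theadE eqb0 negbK.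
  by have -> : [tuple of behead [tuple of y :: v]] = v by exact: val_inj.
have rg : recursive g.
  apply: recursive_not; apply: recursive_or => //; apply: recursive_leq; rec_basic.
have reg (v : n.-tuple nat) : exists y, g [tuple of y :: v] == 0.
  by exists (b v); rewrite gE leqnn orbT.
apply: recursive_ext (recursive_mu reg rg) => v.
case: ex_minnP => m; rewrite gE => Pm minm; apply/esym/find_iota => [|y lt|lt].
- by rewrite minm // gE leqnn orbT.
- by apply: contraTF lt => Py; rewrite -leqNgt minm // gE Py.
- by move: Pm; rewrite leqNgt lt orbF.
Qed.

Lemma recursive_has n (P : nat -> n.-tuple nat -> bool)
    (b : n.-tuple nat -> nat) :
    recursive (fun w : n.+1.-tuple nat =>
      P (thead w) [tuple of behead w] : nat) ->
    recursive b ->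
  recursive (fun v => has (fun y => P y v) (iota 0 (b v)) : nat).
Proof.
move=> rP rb; apply: recursive_ext (_ : recursive
    (fun v => (find (P^~ v) (iota 0 (b v))).+1 <= b v : nat)) => [v|].
  by rewrite has_find size_iota.
by apply: recursive_leq => //; apply: recursive_S; exact: recursive_find.
Qed.

(* The head symbol of the body selects the closure lemma: plain unification
   would unfold the arithmetic operations. *)
Ltac rec_arith := cbv beta; first [assumption | lazymatch goal with
  | |- recursive (fun w => nat_of_bool (_ && _)) => apply: recursive_and
  | |- recursive (fun w => nat_of_bool (_ || _)) => apply: recursive_or
  | |- recursive (fun w => nat_of_bool (~~ _)) => apply: recursive_not
  | |- recursive (fun w => nat_of_bool (_ <= _)) => apply: recursive_leq
  | |- recursive (fun w => nat_of_bool (_ == 0)) => apply: recursive_eq0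
  | |- recursive (fun w => nat_of_bool (_ == _)) => apply: recursive_eqn
  | |- recursive (fun w => nat_of_bool (has _ (iota 0 _))) =>
      apply: recursive_has
  | |- recursive (fun w => _ + _) => apply: recursive_addn
  | |- recursive (fun w => _ - _) => apply: recursive_subn
  | |- recursive (fun w => _ * _) => apply: recursive_muln
  | |- recursive (fun w => _ ^ _) => apply: recursive_expn
  | |- recursive (fun w => _.-1) => apply: recursive_pred
  | |- recursive (fun w => _.+1) => apply: recursive_S
  | |- recursive (fun w => if _ then _ else _) => apply: recursive_ifb
  | |- recursive (fun w => find _ (iota 0 _)) => apply: recursive_find
  | |- recursive (fun w => iteri _ _ _) => apply: recursive_iteri
  | |- _ => first [ exact: recursive_thead | exact: recursive_thead1
    | apply: recursive_const
    | apply: recursive_behead; assumption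
    | apply: recursive_behead2; assumption ]
  end].

Lemma recursive_divn n (f g : n.-tuple nat -> nat) :
  recursive f -> recursive g -> recursive (fun v => f v %/ g v).
Proof.
move=> rf rg; apply: recursive_ext (_ : recursive
    (fun v => find (fun y => (g v == 0) || (f v < y.+1 * g v)) (iota 0 (f v))))
  => [v|]; last by repeat rec_arith.
set m := f v; set d := g v; set p := fun y => _.
have [d0|d0] := posnP d.
  by rewrite d0 divn0; case: m @p => // m p; rewrite /= /p d0.
have pE y : p y = (m %/ d <= y) by rewrite /p (gtn_eqF d0) /= -ltn_divLR.
apply: find_iota => [|y lt|_]; first exact: leq_div.
- by rewrite pE leqNgt lt.
- by rewrite pE.
Qed.

Lemma recursive_dvdn n (f g : n.-tuple nat -> nat) :
  recursive f -> recursive g -> recursive (fun v => f v %| g v : nat).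
Proof.
move=> rf rg; apply: recursive_ext (_ : recursive
    (fun v => g v %/ f v * f v == g v : nat)) => [v|]; first by rewrite -dvdn_eq.
by repeat first [rec_arith | apply: recursive_divn].
Qed.

(** The gcd is the first common divisor met when counting down from the sum of
    the arguments, which bounds it even if one of them is 0. *)
Lemma recursive_gcdn n (f g : n.-tuple nat -> nat) :
  recursive f -> recursive g -> recursive (fun v => gcdn (f v) (g v)).
Proof.
move=> rf rg; apply: recursive_ext (_ : recursive
    (fun v => f v + g v - find (fun y => (f v + g v - y %| f v) &&
        (f v + g v - y %| g v)) (iota 0 (f v + g v)))) => [v|]; last first.
  by repeat first [rec_arith | apply: recursive_dvdn].
set a := f v; set b := g v; set p := fun y => _.
have [/eqP|ab0] := posnP (a + b).
  by rewrite addn_eq0 => /andP[/eqP -> /eqP ->].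
have g_le : gcdn a b <= a + b.
  case: (posnP a) => [->|a0]; first by rewrite gcd0n.
  by rewrite (leq_trans (dvdn_leq a0 (dvdn_gcdl _ _))) ?leq_addr.
have g0 : 0 < gcdn a b by rewrite gcdn_gt0 -addn_gt0.
have pE y : p y = (a + b - y %| gcdn a b) by rewrite /p dvdn_gcd.
rewrite (@find_iota _ _ (a + b - gcdn a b)) ?leq_subr ?subKn // => [y lt|_].
  rewrite pE; apply/negP => /(dvdn_leq g0); rewrite leqNgt ltn_subRL addnC.
  by rewrite -ltn_subRL lt.
by rewrite pE subKn.
Qed.

Lemma recursive_logn n p (f : n.-tuple nat -> nat) : prime p ->
  recursive f -> recursive (fun v => logn p (f v)).
Proof.
move=> p_pr rf; apply: recursive_ext (_ : recursive
    (fun v => find (fun y => ~~ (p ^ y.+1 %| f v)) (iota 0 (f v)))) => [v|];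
  last by repeat first [rec_arith | apply: recursive_dvdn].
set m := f v; have [->|m0] := posnP m; first by rewrite logn0.
set q := fun y => _; have qE y : q y = (logn p m <= y).
  by rewrite /q pfactor_dvdn // -leqNgt.
apply: find_iota => [|y lt|_]; first exact: ltnW (ltn_logl p m0).
- by rewrite qE leqNgt lt.
- by rewrite qE.
Qed.

Local Open Scope ring_scope.

(** * The expansion as a dynamical system on the rationals *)

Section RationalExpansion.
Variables (l : nat) (pr : prime l).
Implicit Types (x : rat) (n : nat).

Definition rat_floor x := padic_floor (padic_of_rat pr x).

(** Since 0^-1 = 0, termination of the expansion is arrival at the fixed
    point 0. *)
Definition ruban_map x := (x - rat_floor x)^-1.

Let l_gt0 : 0 < l%:R :> rat.
Proof. by rewrite ltr0n prime_gt0. Qed.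

Let l_neq0 : l%:R != 0 :> rat.
Proof. by rewrite lt0r_neq0. Qed.

Lemma rat_floor_eq x a : in_Zinv l a -> 0 <= a < l%:R ->
  padic_abs l (x - a) < 1 -> rat_floor x = a.
Proof.
move=> aZ al xa; apply: padic_floor_unique (padic_floorP _) _.
by split => //; rewrite -rmorphB padic_norm_of_rat.
Qed.

Lemma rat_floor_ge0 x : 0 <= rat_floor x.
Proof. by have [_ /andP[]] := padic_floorP (padic_of_rat pr x). Qed.

Lemma rat_floor_lt1 x : padic_abs l (x - rat_floor x) < 1.
Proof.
have [_ _] := padic_floorP (padic_of_rat pr x).
by rewrite -rmorphB padic_norm_of_rat.
Qed.

Lemma rat_floor0 : rat_floor 0 = 0.
Proof.
apply: rat_floor_eq; first by exists 0, 0%N; rewrite mul0r.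
  by rewrite lexx.
by rewrite subr0 padic_abs0.
Qed.

Lemma ruban_map0 : ruban_map 0 = 0.
Proof. by rewrite /ruban_map rat_floor0 subr0 invr0. Qed.

Lemma iter_ruban_map0 n : iter n ruban_map 0 = 0.
Proof. by elim: n => //= n ->; exact: ruban_map0. Qed.

Lemma ruban_map_lt0 x : x < 0 -> ruban_map x < 0.
Proof.
by move=> x0; rewrite invr_lt0 subr_lt0 (lt_le_trans x0) ?rat_floor_ge0.
Qed.

Lemma iter_ruban_map_lt0 n x : x < 0 -> iter n ruban_map x < 0.
Proof. by move=> x0; elim: n => //= n; exact: ruban_map_lt0. Qed.

Lemma coprime_pr_gt0 w : coprime l w -> (0 < w)%N.
Proof.
by case: w => //; rewrite /coprime gcdn0 => /eqP l1; move: pr; rewrite l1.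
Qed.

(** The numerator c solves c w = u modulo L = l^(e+1); it exists since w is
    invertible modulo L.  The exponent e may exceed the one in the reduced form:
    the algorithm below relies on this. *)
Lemma rat_floor_frac (u : int) (w e : nat) : coprime l w ->
  exists c t, [/\ (c < l ^ e.+1)%N, u = c%:Z * w%:Z + t * (l ^ e.+1)%N%:Z &
    rat_floor (u%:~R / (l ^ e * w)%:R) = c%:R / (l ^ e)%:R].
Proof.
move=> lw; have w0 : (0 < w)%N.
  exact: coprime_pr_gt0.
pose L : int := (l ^ e.+1)%N%:Z.
have L0 : 0 < L by rewrite ltz_nat expn_gt0 prime_gt0.
have /coprimezP[[a b] /= ab] : coprimez w%:Z L.
  by rewrite coprimezE /= coprime_sym coprimeXl.
pose c := absz (u * a %% L)%Z; have cE : c%:Z = (u * a %% L)%Z.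
  by rewrite abszE ger0_norm // modz_ge0 ?gt_eqF.
have cL : (c < l ^ e.+1)%N by rewrite -ltz_nat cE ltz_pmod.
pose t := u * b + (u * a %/ L)%Z * w%:Z.
have uE : u = c%:Z * w%:Z + t * L.
  rewrite -[LHS]mulr1 -ab mulrDr mulrA {1}(divz_eq (u * a) L) -cE /t; ring.
have w0' : w%:R != 0 :> rat by rewrite pnatr_eq0 -lt0n.
exists c, t; split => //; apply: rat_floor_eq.
- by exists c%:Z, e; rewrite natrX.
- rewrite divr_ge0 ?ler0n //= ltr_pdivrMr ?ltr0n ?expn_gt0 ?prime_gt0 //.
  by rewrite -natrM ltr_nat -expnS.
rewrite (_ : _ - _ = (t * l%:Z)%:~R / w%:R); last first.
  rewrite uE /L !(intrD, intrM) -!pmulrn !natrM !natrX exprS.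
  by field; rewrite w0' expf_neq0 // l_neq0.
rewrite padic_absM // padic_absV // padic_abs_nat // logn_coprime //.
rewrite expr0 !invr1 mulr1.
by have := @padic_dvd_abs_lt l pr (t * l%:Z) 0; rewrite expr0 invr1;
  apply; rewrite abszM /= expn1 dvdn_mull.
Qed.

Lemma ruban_map_frac (u : int) (w e : nat) : coprime l w ->
  exists c t, [/\ (c < l ^ e.+1)%N, u = c%:Z * w%:Z + t * (l ^ e.+1)%N%:Z &
    ruban_map (u%:~R / (l ^ e * w)%:R) = w%:R / (l%:R * t%:~R)].
Proof.
move=> lw; have [c [t [cL uE fE]]] := rat_floor_frac u e lw.
exists c, t; split => //; rewrite /ruban_map fE -[RHS]invf_div; congr (_^-1).
have w0 : w%:R != 0 :> rat by rewrite pnatr_eq0 -lt0n coprime_pr_gt0.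
rewrite {1}uE !(intrD, intrM) -!pmulrn !natrM !natrX exprS.
by field; rewrite w0 expf_neq0 // l_neq0.
Qed.

(** Here u = -1 and w = 1, and -1 = (L - 1) - L gives c = L - 1 and t = -1. *)
Lemma ruban_map_Ninv_pow e : ruban_map (- ((l ^ e)%:R)^-1) = - l%:R^-1.
Proof.
have [c [t [cL uE]]] := ruban_map_frac (-1) e (coprimen1 l).
rewrite muln1 mulN1r => ->.
suff -> : t = -1 by rewrite mulrN1 div1r invrN.
have L0 : (0 < l ^ e.+1)%N by rewrite expn_gt0 prime_gt0.
move: uE cL L0; move: (l ^ e.+1)%N => L; rewrite mulr1; nia.
Qed.

Lemma ruban_map_Ninv : ruban_map (- l%:R^-1) = - l%:R^-1.
Proof. by have := ruban_map_Ninv_pow 1; rewrite expn1. Qed.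

(** The two possible ends of an orbit: 0 for a terminating expansion and -1/l
    for a periodic one. *)
Definition settled x := (x == 0) || (x == - l%:R^-1).

Lemma iter_settled n x : settled x -> iter n ruban_map x = x.
Proof.
move=> sx; apply: iter_fix.
by case/orP: sx => /eqP ->; rewrite ?ruban_map0 ?ruban_map_Ninv.
Qed.

Lemma settled_more a b x : (a <= b)%N ->
  settled (iter a ruban_map x) -> settled (iter b ruban_map x).
Proof. by move=> /subnK <- sx; rewrite iterD iter_settled. Qed.

(** Moving the powers of l out of t restores the form u / (l^e w) with w prime
    to l. *)
Lemma frac_split (w : nat) (t : int) : t != 0 ->
  exists w' e', [/\ coprime l w', (w' <= `|t|)%N &
    w%:R / (l%:R * t%:~R) = (-1) ^+ (t < 0)%R * (w%:R / (l ^ e' * w')%:R) :> rat].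
Proof.
move=> t0; have t_gt0 : (0 < `|t|)%N by rewrite absz_gt0.
have [w' lw' tE] := pfactor_coprime pr t_gt0.
exists w', (logn l `|t|).+1; split => //.
  by rewrite tE leq_pmulr // expn_gt0 prime_gt0.
have -> : t%:~R = (-1) ^+ (t < 0)%R * `|t|%N%:R :> rat.
  by rewrite {1}[t]intEsign intrM rmorph_sign -pmulrn.
rewrite expnS -mulnA [(l ^ _ * _)%N]mulnC -tE natrM.
by case: (t < 0)%R; rewrite ?mul1r ?mulN1r ?mulrN ?invrN ?mulrN.
Qed.

(** |t| L = n + c w <= n + (L - 1) w puts |t| below max (n, w) unless n = w. *)
Lemma ruban_map_neg (n w e : nat) : coprime l w -> (0 < n)%N ->
  exists w' e', [/\ coprime l w', (w' < maxn n w)%N || (n == w) &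
    ruban_map (- (n%:R / (l ^ e * w)%:R)) = - (w%:R / (l ^ e' * w')%:R)].
Proof.
move=> lw n0; have w0 := coprime_pr_gt0 lw.
have [c [t [cL uE]]] := ruban_map_frac (- n%:Z) e lw.
rewrite intrN mulNr -pmulrn => ->.
have L1 : (1 < l ^ e.+1)%N by rewrite -(expn0 l) ltn_exp2l ?prime_gt1.
have t0 : t < 0 by nia.
have [w' [e' [lw' w't ->]]] := frac_split w (ltr0_neq0 t0).
exists w', e'; split; rewrite ?t0 ?mulN1r //.
by move: (l ^ e.+1)%N L1 cL uE => L L1 cL uE; nia.
Qed.

(** From n = c w + t L: if t > 0 then t <= n / L < n, and if t < 0 then
    |t| L <= c w < L w. *)
Lemma ruban_map_nonneg (n w e : nat) : coprime l w ->
  let y := ruban_map (n%:R / (l ^ e * w)%:R) in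
  y = 0 \/ exists w' e', coprime l w' /\
    ((w' < n)%N /\ y = w%:R / (l ^ e' * w')%:R \/
     (w' < w)%N /\ y = - (w%:R / (l ^ e' * w')%:R)).
Proof.
move=> lw y; have w0 := coprime_pr_gt0 lw.
have [c [t [cL uE]]] := ruban_map_frac n%:Z e lw.
rewrite -pmulrn -/y => ->.
have [->|t_neq0] := eqVneq t 0; first by left; rewrite mulr0 invr0 mulr0.
right; have [w' [e' [lw' w't ->]]] := frac_split w t_neq0.
exists w', e'; split => //.
have L1 : (1 < l ^ e.+1)%N by rewrite -(expn0 l) ltn_exp2l ?prime_gt1.
move: (l ^ e.+1)%N L1 cL uE => L L1 cL uE.
have [t0|t0] := ltP t 0; rewrite ?mulN1r ?mul1r; [right|left]; split => //; nia.
Qed.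

(** The pair (n, w) becomes (w, w') and then (w', w''), so two steps are needed
    for the maximum to drop when it is attained by w alone. *)
Lemma iter_ruban_map_neg m (n w e : nat) : coprime l w -> (0 < n)%N ->
    (n <= m)%N -> (w <= m)%N ->
  settled (iter m.*2.+1 ruban_map (- (n%:R / (l ^ e * w)%:R))).
Proof.
elim: m n w e => [|m IH] n w e lw n0 nm wm; first by case: n n0 nm.
have [w' [e' [lw' /orP[w'm|/eqP nw] yE]]] := ruban_map_neg e lw n0; last first.
  apply: (@settled_more 1%N) => //=; rewrite nw natrM invfM mulrCA divff.
    by rewrite mulr1 ruban_map_Ninv_pow /settled eqxx orbT.
  by rewrite pnatr_eq0 -lt0n coprime_pr_gt0.
have w0 := coprime_pr_gt0 lw.
have w'm1 : (w' <= m)%N by rewrite -ltnS (leq_trans w'm) // geq_max nm.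
rewrite doubleS iterSr yE.
move: wm; rewrite leq_eqVlt => /predU1P[wE|wm]; last first.
  apply: (@settled_more m.*2.+1) => //; exact: IH.
have [w2 [e2 [lw2 /orP[w2m|/eqP ww'] zE]]] := ruban_map_neg e' lw' w0; last first.
  by move: w'm1; rewrite -ww' wE ltnn.
rewrite iterSr zE; apply: IH; rewrite ?coprime_pr_gt0 //.
by rewrite -ltnS (leq_trans w2m) // geq_max wE leqnn ltnW.
Qed.

(** The sum n + w drops as long as the orbit stays positive.  At the first
    negative term it bounds the numerator and the part of the denominator prime
    to l; then [iter_ruban_map_neg] applies; the factor 3 covers both phases. *)
Lemma iter_ruban_map_nonneg m (n w e : nat) : coprime l w -> (n + w <= m)%N ->
  settled (iter (3 * m).+1 ruban_map (n%:R / (l ^ e * w)%:R)).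
Proof.
elim: m n w e => [|m IH] n w e lw nwm; have w0 := coprime_pr_gt0 lw.
  by move: nwm w0; rewrite leqn0 addn_eq0 => /andP[_ /eqP ->].
rewrite iterSr; have [->|[w' [e' [lw' []]]]] := ruban_map_nonneg n e lw.
- by rewrite iter_ruban_map0 /settled eqxx.
- move=> [w'n ->]; apply: (@settled_more (3 * m).+1); first by lia.
  by apply: IH => //; lia.
- move=> [w'w ->]; apply: (@settled_more m.+1.*2.+1); first by lia.
  by apply: iter_ruban_map_neg => //; lia.
Qed.

Definition settling_time (p q : nat) := (3 * (p + q)).+1.

Lemma settled_iter x :
  settled (iter (settling_time `|numq x| `|denq x|) ruban_map x).
Proof.
have d0 : (0 < `|denq x|)%N by rewrite absz_gt0 denq_neq0.
have [w lw dE] := pfactor_coprime pr d0; set e := logn l _ in dE.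
have wd : (w <= `|denq x|)%N by rewrite {1}dE leq_pmulr // expn_gt0 prime_gt0.
have xE : x = (-1) ^+ (x < 0)%R * (`|numq x|%N%:R / (l ^ e * w)%:R).
  rewrite [(l ^ e * w)%N]mulnC -dE -{1}[x]divq_num_den {1}[numq x]intEsign.
  rewrite numq_lt0 intrM rmorph_sign -!pmulrn -mulrA.
  by rewrite -[in LHS](gtz0_abs (denq_gt0 x)).
move: xE; set p := `|numq x|%N; set q := `|denq x|%N in wd * => ->.
have [x0|x0] := ltP x 0; last first.
  rewrite mul1r; apply: (@settled_more (3 * (p + q)).+1) => //.
  by apply: iter_ruban_map_nonneg; rewrite ?leq_add2l.
rewrite mulN1r; apply: (@settled_more (p + q).*2.+1).
  by rewrite /settling_time; lia.
apply: iter_ruban_map_neg; rewrite ?leq_addr ?(leq_trans wd) ?leq_addl //.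
by rewrite absz_gt0 numq_eq0 lt_eqF.
Qed.

End RationalExpansion.
Arguments settling_time : simpl never.

(** * Termination, signs and periodicity *)

Section Ruban.
Variables (l : nat) (pr : prime l).
Implicit Types (x : rat) (n : nat).
Local Notation T := (ruban_map pr).
Local Notation K x := (settling_time `|numq x| `|denq x|).

Let l_gt0 : 0 < l%:R :> rat.
Proof. by rewrite ltr0n prime_gt0. Qed.

Let Ninv_lt0 : - l%:R^-1 < 0 :> rat.
Proof. by rewrite oppr_lt0 invr_gt0. Qed.

Lemma complete_quotient_of_rat x n :
  complete_quotient (padic_of_rat pr x) n =
    if (0 < n)%N && (iter n T x == 0) then None
    else Some (padic_of_rat pr (iter n T x)).
Proof.
elim: n => // n IH.
rewrite [LHS]/= {}IH [iter n.+1 _ _]iterS.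
case: ifP => [/andP[_ /eqP ->]|_]; first by rewrite ruban_map0 eqxx.
rewrite -rmorphB fmorph_eq0 /ruban_map invr_eq0 /=.
by case: ifP => // _; rewrite div1r fmorphV.
Qed.

Lemma rcf_terminatesP x :
  rcf_terminates (padic_of_rat pr x) <-> exists n, iter n T x = 0.
Proof.
split=> -[n].
  by rewrite complete_quotient_of_rat; case: ifP => // /andP[_ /eqP xn _]; exists n.
move=> xn; exists n.+1.
by rewrite complete_quotient_of_rat iterS xn ruban_map0 eqxx.
Qed.

Lemma rcf_terminates_settled x :
  `[< rcf_terminates (padic_of_rat pr x) >] = (iter (K x) T x == 0).
Proof.
apply/asboolP/eqP => [/rcf_terminatesP [n xn]|xK]; last first.
  by apply/rcf_terminatesP; exists (K x).
rewrite -(iter_settled pr n (settled_iter pr x)) -iterD addnC iterD xn.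
exact: iter_ruban_map0.
Qed.

(** A negative term keeps the orbit negative for ever, hence away from 0;
    conversely an orbit without negative terms cannot settle at -1/l. *)
Lemma rcf_terminates_nonneg x :
  rcf_terminates (padic_of_rat pr x) <->
  complete_quotients_nonneg (padic_of_rat pr x).
Proof.
split=> [/rcf_terminatesP [N xN] n y|nonneg].
  rewrite complete_quotient_of_rat; case: ifP => // _ [<-].
  exists (iter n T x) => //; rewrite leNgt; apply/negP => /(iter_ruban_map_lt0 pr N).
  by rewrite -iterD addnC iterD xN iter_ruban_map0 ltxx.
apply/asboolP; rewrite rcf_terminates_settled.
have /orP[//|/eqP xK] := settled_iter pr x.
have := nonneg (K x); rewrite complete_quotient_of_rat xK lt_eqF // andbF.
move=> /(_ _ erefl)[q /fmorph_inj <-].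
by rewrite leNgt Ninv_lt0.
Qed.

Lemma rat_floor_ruban_map x y :
  y != 0 -> T x = y -> rat_floor pr x = x - y^-1.
Proof. by move=> y0 <-; rewrite invrK opprB addrCA subrr addr0. Qed.

Lemma rat_floor_Ninv : rat_floor pr (- l%:R^-1) = l%:R - l%:R^-1.
Proof.
rewrite (rat_floor_ruban_map _ (ruban_map_Ninv pr)) ?lt_eqF //.
by rewrite invrN invrK opprK addrC.
Qed.

Section NonTerminating.
Variable x : rat.
Hypothesis nt : ~ rcf_terminates (padic_of_rat pr x).

Lemma iter_neq0 n : iter n T x != 0.
Proof. by apply/eqP => xn; apply: nt; apply/rcf_terminatesP; exists n. Qed.

Lemma partial_quotient_of_rat n :
  partial_quotient (padic_of_rat pr x) n = Some (rat_floor pr (iter n T x)).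
Proof.
by rewrite /partial_quotient complete_quotient_of_rat (negPf (iter_neq0 n)) andbF.
Qed.

Lemma iter_Ninv n : (K x <= n)%N -> iter n T x = - l%:R^-1.
Proof.
move=> /subnK <-; have sx := settled_iter pr x.
rewrite iterD iter_settled //; move: sx.
by rewrite /settled (negPf (iter_neq0 _)) => /eqP.
Qed.

Lemma iter_Ninv_trans m n : (m <= n)%N -> iter m T x = - l%:R^-1 ->
  iter n T x = - l%:R^-1.
Proof.
by move=> /subnK <- xm; rewrite iterD xm iter_settled // /settled eqxx orbT.
Qed.

Lemma partial_quotient_settled n : iter n T x = - l%:R^-1 ->
  partial_quotient (padic_of_rat pr x) n = Some (l%:R - l%:R^-1).
Proof. by move=> xn; rewrite partial_quotient_of_rat xn rat_floor_Ninv. Qed.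

(** Periodicity from N on propagates the eventual value l - 1/l of the floors
    back to N.  With this floor, the equation T y = -1/l forces
    y = l - 1/l - l = -1/l, so the orbit itself is at -1/l from N on. *)
Lemma rcf_periodic_fromP N :
  rcf_periodic_from (padic_of_rat pr x) N <-> iter N T x = - l%:R^-1.
Proof.
split=> [[p p0 per]|xN]; last first.
  exists 1%N => // n Nn; rewrite !partial_quotient_settled //.
    exact: iter_Ninv_trans xN.
  by apply: iter_Ninv_trans xN; rewrite (leq_trans Nn) ?leq_addr.
have per_mul k n : (N <= n)%N -> partial_quotient (padic_of_rat pr x) (n + k * p)
    = partial_quotient (padic_of_rat pr x) n.
  move=> Nn; elim: k => [|k IH]; first by rewrite addn0.
  by rewrite mulSn addnCA addnC per ?IH // (leq_trans Nn) ?leq_addr.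
have floorE n : (N <= n)%N -> rat_floor pr (iter n T x) = l%:R - l%:R^-1.
  move=> Nn; have := per_mul (K x) n Nn.
  rewrite partial_quotient_settled ?partial_quotient_of_rat; first by case.
  by apply: iter_Ninv; rewrite (leq_trans _ (leq_addl _ _)) ?leq_pmulr.
have back j : iter (N + j)%N T x = - l%:R^-1 -> iter N T x = - l%:R^-1.
  elim: j => [|j IH]; first by rewrite addn0.
  rewrite addnS iterS => TE; apply: IH.
  have := floorE (N + j)%N (leq_addr _ _).
  rewrite (rat_floor_ruban_map _ TE) ?lt_eqF // invrN invrK opprK.
  by move=> /(canRL (addrK _)) ->; rewrite addrAC subrr add0r.
by apply: (back (K x)); apply: iter_Ninv; rewrite leq_addl.
Qed.

Definition preperiod_length :=
  find (fun n => iter n T x == - l%:R^-1) (iota 0 (K x).+1).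

Lemma rcf_preperiod_of_rat :
  rcf_preperiod (padic_of_rat pr x)
    [seq rat_floor pr (iter n T x) | n <- iota 0 preperiod_length].
Proof.
split; rewrite ?size_map ?size_iota.
- rewrite -map_comp; apply: eq_map => n /=; exact/esym/partial_quotient_of_rat.
- apply/rcf_periodic_fromP.
  have hasN : has (fun n => iter n T x == - l%:R^-1) (iota 0 (K x).+1).
    by apply/hasP; exists (K x); rewrite ?mem_iota ?leqnn // iter_Ninv.
  have := nth_find 0%N hasN; rewrite nth_iota; first by move/eqP.
  by move: hasN; rewrite has_find size_iota.
- move=> N /rcf_periodic_fromP xN; rewrite leqNgt; apply/negP => lt.
  have := before_find 0%N lt; rewrite nth_iota ?xN ?eqxx //.
  by rewrite (leq_trans lt) // -[leqRHS](size_iota 0) find_size.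
Qed.

Lemma rcf_eventually_constant : rcf_periodic (padic_of_rat pr x) /\
  exists N, forall n, (N <= n)%N ->
    partial_quotient (padic_of_rat pr x) n = Some (l%:R - l%:R^-1).
Proof.
split.
  by split => //; exists (K x); apply/rcf_periodic_fromP; exact: iter_Ninv.
by exists (K x) => n Kn; apply: partial_quotient_settled; exact: iter_Ninv.
Qed.

End NonTerminating.
End Ruban.

(** * The algorithms *)

Section Algorithm.
Local Open Scope nat_scope.

(** [CodeSeq.code] is the iteration of this pairing function, whose first
    component is recovered as the 2-adic valuation. *)
Definition code_cons a t := 2 ^ a * t.*2.+1.
Definition code_head r := logn 2 r.
Definition code_tail r := r %/ 2 ^ (code_head r).+1.

Lemma code_headK a t : code_head (code_cons a t) = a.
Proof.
rewrite /code_head /code_cons lognM ?expn_gt0 // pfactorK //.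
by rewrite logn_coprime ?addn0 // coprime2n /= odd_double.
Qed.

Lemma code_tailK a t : code_tail (code_cons a t) = t.
Proof.
rewrite /code_tail code_headK /code_cons expnS mulnC divnMr ?expn_gt0 //.
by rewrite divn2 /= uphalf_double.
Qed.

(** A state of the computation is the code of a sign flag, a numerator and a
    denominator, without any reduction.  A denominator 0 codes the number 0, in
    accordance with 0^-1 = 0. *)
Definition frac_code s p q := CodeSeq.code [:: s; p; q].

Definition sgn_of r := code_head r.
Definition num_of r := code_head (code_tail r).
Definition den_of r := code_head (code_tail (code_tail r)).

Lemma frac_codeK s p q : (sgn_of (frac_code s p q) = s) *
  (num_of (frac_code s p q) = p) * (den_of (frac_code s p q) = q).
Proof.
rewrite /frac_code /= -![2 ^ _ * _]/(code_cons _ _).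
by rewrite /sgn_of /num_of /den_of !(code_tailK, code_headK).
Qed.

(** |a / b|_l < 1 means that the valuation of a exceeds that of b, which is
    witnessed by a power of l dividing a and not b. *)
Definition abs_lt1 l a b :=
  has (fun k => (l ^ k %| a) && ~~ (l ^ k %| b)) (iota 0 b.+1).

(** Numerator, sign and denominator of x - c / l^q for x = p / q up to the sign
    s.  The valuation of q is at most q, so l^q is a possible denominator for
    the floor of x, and no factorisation of q is needed. *)
Definition rem_num l s p q c :=
  if s == 0 then (p * l ^ q - c * q) + (c * q - p * l ^ q)
  else p * l ^ q + c * q.
Definition rem_sgn l s p q c : nat := (s != 0) || (p * l ^ q < c * q).
Definition rem_den l q := q * l ^ q.
Definition floor_num l s p q :=
  find (fun c => abs_lt1 l (rem_num l s p q c) (rem_den l q))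
    (iota 0 (l ^ q.+1)).

Definition step l r :=
  let c := floor_num l (sgn_of r) (num_of r) (den_of r) in
  frac_code (rem_sgn l (sgn_of r) (num_of r) (den_of r) c)
    (rem_den l (den_of r))
    (rem_num l (sgn_of r) (num_of r) (den_of r) c).

Definition zero_code r := (num_of r == 0) || (den_of r == 0).
Definition Ninv_code l r :=
  [&& sgn_of r != 0, den_of r != 0 & num_of r * l == den_of r].

(** [rat_code] reads numerator and denominator in lowest terms, so the floor
    c / l^q has to be reduced. *)
Definition push_floor l r t :=
  let c := floor_num l (sgn_of r) (num_of r) (den_of r) in
  let g := gcdn c (l ^ den_of r) in
  code_cons 0 (code_cons (c %/ g) (code_cons (l ^ den_of r %/ g) t)).

Definition decide (v : 4.-tuple nat) : nat :=
  let p := nth 0 v 2 in let q := nth 0 v 3 in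
  zero_code (iter (settling_time p q) (step (nth 0 v 0))
    (frac_code (nth 0 v 1) p q)).

Definition settling_index l r K :=
  find (fun n => Ninv_code l (iter n (step l) r)) (iota 0 K.+1).

(** A code is built from its last entry, so the orbit is visited backwards. *)
Definition preperiod_code l r K :=
  let N := settling_index l r K in
  iteri N (fun j => push_floor l (iter (N - j.+1) (step l) r)) 0.

Definition preperiod (v : 4.-tuple nat) : nat :=
  let p := nth 0 v 2 in let q := nth 0 v 3 in
  preperiod_code (nth 0 v 0) (frac_code (nth 0 v 1) p q) (settling_time p q).

Lemma recursive_code_cons n (f g : n.-tuple nat -> nat) :
  recursive f -> recursive g -> recursive (fun v => code_cons (f v) (g v)).
Proof.
move=> rf rg; apply: recursive_ext (_ : recursive
  (fun v => 2 ^ f v * (g v + g v).+1)) => [v|]; first by rewrite addnn.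
by repeat rec_arith.
Qed.

Lemma recursive_code_head n (f : n.-tuple nat -> nat) :
  recursive f -> recursive (fun v => code_head (f v)).
Proof. exact: recursive_logn. Qed.

Lemma recursive_code_tail n (f : n.-tuple nat -> nat) :
  recursive f -> recursive (fun v => code_tail (f v)).
Proof.
move=> rf; apply: recursive_divn => //; apply: recursive_expn.
  exact: recursive_const.
by apply: recursive_S; exact: recursive_code_head.
Qed.

Lemma recursive_sgn_of n (f : n.-tuple nat -> nat) :
  recursive f -> recursive (fun v => sgn_of (f v)).
Proof. exact: recursive_code_head. Qed.

Lemma recursive_num_of n (f : n.-tuple nat -> nat) :
  recursive f -> recursive (fun v => num_of (f v)).
Proof. by move=> rf; do !apply: recursive_code_head || apply: recursive_code_tail. Qed.

Lemma recursive_den_of n (f : n.-tuple nat -> nat) :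
  recursive f -> recursive (fun v => den_of (f v)).
Proof.
move=> rf; apply: recursive_code_head; apply: recursive_code_tail.
exact: recursive_code_tail.
Qed.

Lemma recursive_frac_code n (s p q : n.-tuple nat -> nat) :
  recursive s -> recursive p -> recursive q ->
  recursive (fun v => frac_code (s v) (p v) (q v)).
Proof.
by move=> rs rp rq; do 3!(apply: recursive_code_cons => //); exact: recursive_const.
Qed.

Lemma recursive_rem_num n (l s p q c : n.-tuple nat -> nat) :
  recursive l -> recursive s -> recursive p -> recursive q -> recursive c ->
  recursive (fun v => rem_num (l v) (s v) (p v) (q v) (c v)).
Proof. by move=> rl rs rp rq rc; rewrite /rem_num; repeat rec_arith. Qed.

Lemma recursive_rem_sgn n (l s p q c : n.-tuple nat -> nat) :
  recursive l -> recursive s -> recursive p -> recursive q -> recursive c ->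
  recursive (fun v => rem_sgn (l v) (s v) (p v) (q v) (c v)).
Proof. by move=> rl rs rp rq rc; rewrite /rem_sgn; repeat rec_arith. Qed.

Lemma recursive_rem_den n (l q : n.-tuple nat -> nat) :
  recursive l -> recursive q -> recursive (fun v => rem_den (l v) (q v)).
Proof. by move=> rl rq; rewrite /rem_den; repeat rec_arith. Qed.

Lemma recursive_abs_lt1 n (l a b : n.-tuple nat -> nat) :
  recursive l -> recursive a -> recursive b ->
  recursive (fun v => abs_lt1 (l v) (a v) (b v) : nat).
Proof.
move=> rl ra rb; rewrite /abs_lt1.
by repeat first [rec_arith | apply: recursive_dvdn].
Qed.

Lemma recursive_floor_num n (l s p q : n.-tuple nat -> nat) :
  recursive l -> recursive s -> recursive p -> recursive q ->
  recursive (fun v => floor_num (l v) (s v) (p v) (q v)).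
Proof.
move=> rl rs rp rq; apply: recursive_find; last by repeat rec_arith.
apply: recursive_abs_lt1;
  first [apply: recursive_rem_num | apply: recursive_rem_den | idtac];
  by repeat rec_arith.
Qed.

Lemma recursive_step n (l r : n.-tuple nat -> nat) :
  recursive l -> recursive r -> recursive (fun v => step (l v) (r v)).
Proof.
move=> rl rr; rewrite /step.
have rs := recursive_sgn_of rr; have rp := recursive_num_of rr.
have rq := recursive_den_of rr; have rc := recursive_floor_num rl rs rp rq.
apply: recursive_frac_code; last exact: recursive_rem_num.
  exact: recursive_rem_sgn.
exact: recursive_rem_den.
Qed.

Lemma recursive_orbit n (b l r : n.-tuple nat -> nat) :
  recursive b -> recursive l -> recursive r ->
  recursive (fun v => iter (b v) (step (l v)) (r v)).
Proof.
move=> rb rl rr; apply: recursive_ext (_ : recursive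
    (fun v => iteri (b v) (fun _ => step (l v)) (r v))) => [v|].
  by elim: (b v) => //= k ->.
apply: recursive_iteri => //; apply: recursive_step; by repeat rec_arith.
Qed.

Lemma recursive_zero_code n (r : n.-tuple nat -> nat) :
  recursive r -> recursive (fun v => zero_code (r v) : nat).
Proof.
move=> rr; have rp := recursive_num_of rr; have rq := recursive_den_of rr.
by rewrite /zero_code; repeat rec_arith.
Qed.

Lemma recursive_Ninv_code n (l r : n.-tuple nat -> nat) :
  recursive l -> recursive r -> recursive (fun v => Ninv_code (l v) (r v) : nat).
Proof.
move=> rl rr; have rs := recursive_sgn_of rr.
have rp := recursive_num_of rr; have rq := recursive_den_of rr.
by rewrite /Ninv_code; repeat rec_arith.
Qed.

Lemma recursive_push_floor n (l r t : n.-tuple nat -> nat) :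
  recursive l -> recursive r -> recursive t ->
  recursive (fun v => push_floor (l v) (r v) (t v)).
Proof.
move=> rl rr rt; rewrite /push_floor.
have rs := recursive_sgn_of rr; have rp := recursive_num_of rr.
have rq := recursive_den_of rr; have rc := recursive_floor_num rl rs rp rq.
have rL := recursive_expn rl rq; have rg := recursive_gcdn rc rL.
by do 3!(apply: recursive_code_cons => //;
  first [exact: recursive_const | exact: recursive_divn | idtac]).
Qed.

Lemma recursive_nth n i : recursive (fun v : n.-tuple nat => nth 0 v i).
Proof.
have [lt|le] := ltnP i n.
  apply: recursive_ext (recursive_proj (Ordinal lt)) => v.
  exact: tnth_nth.
apply: recursive_ext (recursive_const n 0) => v.
by rewrite nth_default ?size_tuple.
Qed.

Lemma recursive_settling_time n (p q : n.-tuple nat -> nat) :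
  recursive p -> recursive q -> recursive (fun v => settling_time (p v) (q v)).
Proof. by move=> rp rq; rewrite /settling_time; repeat rec_arith. Qed.

Lemma recursive_decide : recursive decide.
Proof.
apply: recursive_zero_code; apply: recursive_orbit.
- apply: recursive_settling_time; exact: recursive_nth.
- exact: recursive_nth.
- apply: recursive_frac_code; exact: recursive_nth.
Qed.

Lemma recursive_settling_index n (l r K : n.-tuple nat -> nat) :
  recursive l -> recursive r -> recursive K ->
  recursive (fun v => settling_index (l v) (r v) (K v)).
Proof.
move=> rl rr rK; apply: recursive_find; last exact: recursive_S.
by apply: recursive_Ninv_code;
  first [apply: recursive_orbit | idtac]; repeat rec_arith.
Qed.

Lemma recursive_preperiod_code n (l r K : n.-tuple nat -> nat) :
  recursive l -> recursive r -> recursive K ->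
  recursive (fun v => preperiod_code (l v) (r v) (K v)).
Proof.
move=> rl rr rK; have rN := recursive_settling_index rl rr rK.
suff rec_push (N : n.-tuple nat -> nat) : recursive N -> recursive (fun v =>
    iteri (N v)
      (fun j => push_floor (l v) (iter (N v - j.+1) (step (l v)) (r v))) 0).
  exact: rec_push rN.
move=> {}rN; apply: recursive_iteri => //; last exact: recursive_const.
by apply: recursive_push_floor;
  first [apply: recursive_orbit | idtac]; repeat rec_arith.
Qed.

Lemma recursive_preperiod : recursive preperiod.
Proof.
apply: recursive_preperiod_code; first exact: recursive_nth.
  apply: recursive_frac_code; exact: recursive_nth.
apply: recursive_settling_time; exact: recursive_nth.
Qed.

End Algorithm.

(** * Correctness of the algorithms *)

Section Correctness.
Variables (l : nat) (pr : prime l).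
Local Notation T := (ruban_map pr).
Local Notation floor := (rat_floor pr).

Definition frac (s p q : nat) : rat := (-1) ^+ (s != 0%N) * (p%:R / q%:R).

Let l_gt0 : 0 < l%:R :> rat.
Proof. by rewrite ltr0n prime_gt0. Qed.

Lemma frac_eq0 s p q : (frac s p q == 0) = (p == 0%N) || (q == 0%N).
Proof. by rewrite /frac mulf_eq0 signr_eq0 mulf_eq0 invr_eq0 !pnatr_eq0. Qed.

Lemma frac_eqNinv s p q : (frac s p q == - l%:R^-1) =
  [&& s != 0%N, q != 0%N & (p * l == q)%N].
Proof.
have lN0 : l%:R != 0 :> rat by rewrite gt_eqF.
have Ninv_neq0 : (0 == - l%:R^-1 :> rat) = false.
  by rewrite eq_sym oppr_eq0 invr_eq0 (negPf lN0).
have [->|q0] := eqVneq q 0%N.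
  by rewrite /frac invr0 !mulr0 Ninv_neq0 andbF.
have qN0 : q%:R != 0 :> rat by rewrite pnatr_eq0.
rewrite /frac; case: (s == 0%N) => /=.
  rewrite mul1r gt_eqF // (lt_le_trans (y := 0)) ?divr_ge0 ?ler0n //.
  by rewrite oppr_lt0 invr_gt0.
rewrite mulN1r eqr_opp -[l%:R^-1]div1r eqr_div // mul1r -natrM eqr_nat.
by [].
Qed.

Lemma frac_rat_code x : frac (x < 0)%R `|numq x|%N `|denq x|%N = x.
Proof.
rewrite /frac eqb0 negbK -{4}[x]divq_num_den {2}[numq x]intEsign numq_lt0.
rewrite intrM rmorph_sign -!pmulrn -mulrA.
by rewrite -[X in _ = _ * (_ / X%:~R)](gtz0_abs (denq_gt0 x)).
Qed.

Lemma abs_lt1P s a b : (0 < b)%N ->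
  abs_lt1 l a b = (padic_abs l (frac s a b) < 1).
Proof.
move=> b0; rewrite /frac padic_absM // (_ : padic_abs l _ = 1); last first.
  by case: (~~ _); rewrite ?expr1 ?padic_absN ?padic_abs1.
rewrite mul1r padic_absM // padic_absV // (@padic_abs_nat l b b0) invrK.
have logb := ltn_logl l b0.
have ndvd : ~~ (l ^ (logn l b).+1 %| b)%N by rewrite pfactor_dvdn // ltnn.
have [->|a0] := posnP a.
  rewrite padic_abs0 mul0r ltr01; apply/hasP; exists (logn l b).+1.
    by rewrite mem_iota /= add0n ltnS.
  by rewrite dvdn0.
rewrite (@padic_abs_nat l a a0) mulrC ltr_pdivrMr ?exprn_gt0 // mul1r.
rewrite ltr_eXn2l ?ltr1n ?prime_gt1 //; apply/hasP/idP => [[k _ /andP[]]|lt].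
  by rewrite !pfactor_dvdn // -ltnNge => ka /leq_trans; apply.
exists (logn l b).+1; first by rewrite mem_iota /= add0n ltnS.
by rewrite ndvd pfactor_dvdn // lt.
Qed.

Lemma rem_fracE s p q c : (0 < q)%N -> frac s p q - c%:R / (l ^ q)%:R =
  frac (rem_sgn l s p q c) (rem_num l s p q c) (rem_den l q).
Proof.
move=> q0; have qN0 : q%:R != 0 :> rat by rewrite pnatr_eq0 -lt0n.
have LN0 : (l ^ q)%:R != 0 :> rat by rewrite pnatr_eq0 -lt0n expn_gt0 prime_gt0.
rewrite /frac /rem_sgn /rem_num /rem_den; case: (s == 0%N) => /=.
  rewrite eqb0 negbK mul1r; case: (ltnP (p * l ^ q) (c * q)) => h.
    rewrite (eqP (ltnW h)) add0n natrB ?(ltnW h) // !natrM mulN1r.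
    by field; rewrite LN0 qN0.
  rewrite (eqP h) addn0 natrB // !natrM mul1r.
  by field; rewrite LN0 qN0.
rewrite natrD !natrM; by field; rewrite LN0 qN0.
Qed.

Lemma rem_den_gt0 q : (0 < q)%N -> (0 < rem_den l q)%N.
Proof. by move=> q0; rewrite muln_gt0 q0 expn_gt0 prime_gt0. Qed.

(** The search succeeds because [rat_floor_frac] applies with exponent q, and
    what it returns is the floor by uniqueness. *)
Lemma rat_floor_num s p q : (0 < q)%N ->
  floor (frac s p q) = (floor_num l s p q)%:R / (l ^ q)%:R.
Proof.
move=> q0; set x := frac s p q.
have lt1E c : abs_lt1 l (rem_num l s p q c) (rem_den l q) =
    (padic_abs l (x - c%:R / (l ^ q)%:R) < 1).
  by rewrite rem_fracE //; apply: abs_lt1P; exact: rem_den_gt0.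
have hasc : has (fun c => abs_lt1 l (rem_num l s p q c) (rem_den l q))
    (iota 0 (l ^ q.+1)).
  have [w lw qE] := pfactor_coprime pr q0; set e := logn l q in qE.
  have eq : (e <= q)%N by rewrite ltnW // ltn_logl.
  have w0 := coprime_pr_gt0 pr lw.
  pose u : int := (-1) ^+ (s != 0%N) * (p * l ^ (q - e))%N%:Z.
  have xE : x = u%:~R / (l ^ q * w)%:R.
    have lN0 : l%:R != 0 :> rat by rewrite gt_eqF.
    have wN0 : w%:R != 0 :> rat by rewrite pnatr_eq0 -lt0n.
    rewrite /x /frac /u intrM rmorph_sign -!pmulrn -mulrA; congr (_ * _).
    rewrite {1}qE -{2}(subnK eq) expnD !natrM !natrX.
    by field; rewrite wN0 !expf_neq0.
  have [c [t [cL _ fE]]] := rat_floor_frac pr u q lw.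
  apply/hasP; exists c; first by rewrite mem_iota.
  by rewrite lt1E -fE -xE rat_floor_lt1.
have := nth_find 0%N hasc; rewrite -/(floor_num l s p q).
have lt : (floor_num l s p q < l ^ q.+1)%N.
  by move: hasc; rewrite has_find size_iota.
rewrite nth_iota // lt1E; apply: rat_floor_eq.
  by exists (floor_num l s p q)%:Z, q; rewrite natrX.
rewrite divr_ge0 ?ler0n //= ltr_pdivrMr ?ltr0n ?expn_gt0 ?prime_gt0 //.
by rewrite -natrM ltr_nat -expnS.
Qed.

Definition decode r := frac (sgn_of r) (num_of r) (den_of r).

Lemma decode_frac_code s p q : decode (frac_code s p q) = frac s p q.
Proof. by rewrite /decode !frac_codeK. Qed.

Lemma zero_codeP r : zero_code r = (decode r == 0).
Proof. by rewrite /decode frac_eq0. Qed.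

Lemma Ninv_codeP r : Ninv_code l r = (decode r == - l%:R^-1).
Proof. by rewrite /decode frac_eqNinv. Qed.

Lemma decode_step r : decode (step l r) = T (decode r).
Proof.
rewrite decode_frac_code /decode.
move: (sgn_of r) (num_of r) (den_of r) => s p q; set c := floor_num _ _ _ _.
have [->|q0] := posnP q.
  rewrite [in RHS]/frac invr0 !mulr0 ruban_map0.
  by rewrite /frac /rem_den mul0n mul0r mulr0.
rewrite /ruban_map rat_floor_num // -/c rem_fracE // /frac.
rewrite invfM invf_div; congr (_ * _); rewrite /rem_sgn eqb0 negbK.
by case: (_ || _); rewrite ?invrN invr1.
Qed.

Lemma decode_orbit n r : decode (iter n (step l) r) = iter n T (decode r).
Proof. by elim: n => //= n IH; rewrite decode_step IH. Qed.

Lemma rat_code_frac c m : (0 < m)%N ->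
  tval (rat_code (c%:R / m%:R)) = [:: 0; c %/ gcdn c m; m %/ gcdn c m]%N.
Proof.
move=> m0; set g := gcdn c m; have g0 : (0 < g)%N by rewrite gcdn_gt0 m0 orbT.
have gN0 : g%:R != 0 :> rat by rewrite pnatr_eq0 -lt0n.
have cg : (g %| c)%N := dvdn_gcdl c m; have mg : (g %| m)%N := dvdn_gcdr c m.
have cop : coprime (c %/ g) (m %/ g).
  rewrite /coprime -(eqn_pmul2r g0) mul1n muln_gcdl !divnK //.
have m'0 : (0 < m %/ g)%N by rewrite divn_gt0 // dvdn_leq.
have -> : c%:R / m%:R = (c %/ g)%N%:~R / (m %/ g)%N%:~R :> rat.
  rewrite -[in LHS](divnK cg) -[in LHS](divnK mg) !natrM -!pmulrn.
  by rewrite -mulf_div divff // mulr1.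
rewrite /rat_code /= coprimeq_num ?coprimeq_den //.
rewrite ltNge divr_ge0 ?ler0z //= gtr0_sg ?mul1r //.
by rewrite eqz_nat gtn_eqF.
Qed.

Lemma push_floorE r t : decode r != 0 -> push_floor l r (CodeSeq.code t) =
  CodeSeq.code (rat_code (floor (decode r)) ++ t).
Proof.
rewrite /decode frac_eq0 negb_or -!lt0n => /andP[_ q0].
by rewrite rat_floor_num // rat_code_frac ?expn_gt0 ?prime_gt0.
Qed.

Lemma decide_correct x : decide [tuple of l :: rat_code x] =
  if `[< rcf_terminates (padic_of_rat pr x) >] then 1%N else 0%N.
Proof.
rewrite rcf_terminates_settled /decide zero_codeP decode_orbit.
rewrite decode_frac_code /= frac_rat_code.
by case: (_ == 0).
Qed.

Lemma preperiod_correct x : ~ rcf_terminates (padic_of_rat pr x) ->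
  exists2 s, rcf_preperiod (padic_of_rat pr x) s &
    preperiod [tuple of l :: rat_code x] = rat_seq_code s.
Proof.
move=> nt.
exists [seq floor (iter n T x) | n <- iota 0 (preperiod_length pr x)].
  exact: rcf_preperiod_of_rat.
pose r := frac_code (x < 0)%R `|numq x|%N `|denq x|%N.
rewrite -[LHS]/(preperiod_code l r (settling_time `|numq x| `|denq x|)).
have rE n : decode (iter n (step l) r) = iter n T x.
  by rewrite decode_orbit decode_frac_code frac_rat_code.
rewrite /preperiod_code.
rewrite (_ : settling_index _ _ _ = preperiod_length pr x); last first.
  by apply: eq_find => n; rewrite Ninv_codeP rE.
set N := preperiod_length pr x; rewrite /rat_seq_code -map_comp.
suff H j : (j <= N)%N ->
    iteri j (fun j => push_floor l (iter (N - j.+1) (step l) r)) 0%N =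
    CodeSeq.code (flatten
      [seq tval (rat_code (floor (iter n T x))) | n <- iota (N - j) j]).
  by rewrite H // subnn.
elim: j => [//|j IH] jN; rewrite [LHS]/= IH ?(ltnW jN) //.
rewrite push_floorE; last by rewrite rE iter_neq0.
by rewrite rE /= subnSK.
Qed.

End Correctness.

Theorem theorem1p1 :
  ((forall (l : nat) (pr : prime l) (a : rat),
      rcf_terminates (padic_of_rat pr a) <->
      complete_quotients_nonneg (padic_of_rat pr a)) /\
   (exists2 decide : 4.-tuple nat -> nat, recursive decide &
      forall (l : nat) (pr : prime l) (a : rat),
        decide [tuple of l :: rat_code a] =
          if `[< rcf_terminates (padic_of_rat pr a) >] then 1%N else 0%N)) /\
  ((forall (l : nat) (pr : prime l) (a : rat),
      ~ rcf_terminates (padic_of_rat pr a) ->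
      rcf_periodic (padic_of_rat pr a) /\
      exists N : nat, forall n : nat, (N <= n)%N ->
        partial_quotient (padic_of_rat pr a) n = Some (l%:R - l%:R^-1)) /\
   (exists2 preperiod : 4.-tuple nat -> nat, recursive preperiod &
      forall (l : nat) (pr : prime l) (a : rat),
        ~ rcf_terminates (padic_of_rat pr a) ->
        exists2 s : seq rat, rcf_preperiod (padic_of_rat pr a) s &
          preperiod [tuple of l :: rat_code a] = rat_seq_code s)).
Proof.
split; split.
- exact: rcf_terminates_nonneg.
- by exists decide; [exact: recursive_decide | exact: decide_correct].
- exact: rcf_eventually_constant.
- by exists preperiod; [exact: recursive_preperiod | exact: preperiod_correct].
Qed.
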